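(* Let $N=\overline{B}_u\times\overline{B}_s$ and let $F$ be a $C^1$ vector field, defined on an open set of $\mathbb{R}^u\times\mathbb{R}^s$ containing $N$, with $F(0)=0$, such that for some constants $\mu,L,M$: $\|F(p)\|\le\mu$ and $\|DF(p)\|\le L$ for all $p\in N$, and $\|DF(p_1)-DF(p_2)\|\le M\|p_1-p_2\|$ for all $p_1,p_2\in N$. Assume that $$[DF(N)]\subset\begin{pmatrix}\mathbf{A}&\boldsymbol{\varepsilon}_1\\ \boldsymbol{\varepsilon}_2&\mathbf{B}\end{pmatrix},$$ where $\mathbf{A},\mathbf{B},\boldsymbol{\varepsilon}_1,\boldsymbol{\varepsilon}_2$ are interval matrices (of sizes $u\times u$, $s\times s$, $u\times s$, $s\times u$ respectively). Let $\alpha_h,\alpha_v\in(0,1)$ and let $c_h,c_v\in\mathbb{R}$ be such that for any $A\in\mathbf{A}$, $B\in\mathbf{B}$, $\varepsilon_1\in\boldsymbol{\varepsilon}_1$, $\varepsilon_2\in\boldsymbol{\varepsilon}_2$, all $x\in\mathbb{R}^u\setminus\{0\}$ and all $y\in\mathbb{R}^s\setminus\{0\}$, $$x^T\Big(A-\tfrac12\big(\|\varepsilon_1\|+\tfrac{1}{\alpha_h}\|\varepsilon_2\|\big)\mathrm{Id}\Big)x>c_h\|x\|^2,$$ $$x^T\Big(A-\tfrac12\big(\|\varepsilon_1\|+\alpha_v\|\varepsilon_2\|\big)\mathrm{Id}\Big)x>c_v\|x\|^2,$$ $$y^T\Big(B+\tfrac12\big(\|\varepsilon_2\|+\alpha_h\|\varepsilon_1\|\big)\mathrm{Id}\Big)y<c_h\|y\|^2,$$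 $$y^T\Big(B+\tfrac12\big(\|\varepsilon_2\|+\tfrac{1}{\alpha_v}\|\varepsilon_1\|\big)\mathrm{Id}\Big)y<c_v\|y\|^2.$$ Let $r^s=\sqrt{1-\alpha_h}$ and $U=\overline{B}_u\times\overline{B}_s(0,r^s)$. If $c_h<c_v$ and $c_h<0$, then there exists a function $w^s:\overline{B}_s(0,r^s)\to\overline{B}_u$ such that $$W^s_{c_h,N}\cap U=\{(w^s(y),y) : y\in\overline{B}_s(0,r^s)\}.$$ Moreover, $w^s$ is Lipschitz with constant $L_s=\sqrt{\alpha_v}$.
   Context: Vector norms are Euclidean, matrix norms are the induced operator norms. $B_k(x,r)$ is the open ball in $\mathbb{R}^k$ of radius $r$ centered at $x$, $B_k=B_k(0,1)$, and bars denote closures. An interval matrix is a matrix whose entries are closed bounded intervals, identified with the set of real matrices whose entries lie in the corresponding intervals. The interval enclosure of the derivative on $N$ is $$[DF(N)]=\Big\{A\in\mathbb{R}^{(u+s)\times(u+s)} : A_{ij}\in\Big[\inf_{p\in N}\tfrac{\partial F_i}{\partial p_j}(p),\ \sup_{p\in N}\tfrac{\partial F_i}{\partial p_j}(p)\Big]\text{ for all }i,j\Big\}.$$ $\phi_t(p)$ denotes the (local) flow of the ODE $p'=F(p)$. Strong stable manifold for the flow: for a neighborhood $V$ of zero and $\lambda<0$, $W^s_{\lambda,V}$ is the set of all points $p$ such that (1) $\phi_t(p)\in V$ for all $t\ge 0$; and (2) there exists a constant $C>0$ (which can depend on $p$) such that $\|\phi_t(p)\|\le Ce^{t\lambda}$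 for all $t\ge 0$. Here $V=N$ and $\lambda=c_h$. *)

(* Defs.v *)
From HB Require Import structures.
From mathcomp Require Import all_boot all_order all_algebra.
From mathcomp Require Import all_classical all_reals all_analysis.

Set Implicit Arguments.
Unset Strict Implicit.
Unset Printing Implicit Defensive.

Import Order.TTheory GRing.Theory Num.Theory.
Import numFieldNormedType.Exports.

Local Open Scope classical_set_scope.
Local Open Scope ring_scope.

Section Norms.
Context {R : realType}.

(* The library norm on matrices is the max norm.  It induces the same topology
   as the Euclidean norm, so the library's open, closure, continuous,
   differentiable and is_derive are used unchanged. *)
Definition enorm n (x : 'cV[R]_n) : R := Num.sqrt (\sum_i x i 0 ^+ 2).

Definition opnorm m n (A : 'M[R]_(m, n)) : R :=
  sup [set enorm (A *m x) | x in [set x : 'cV[R]_n | enorm x <= 1]].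

Definition eball n (x : 'cV[R]_n) (r : R) : set 'cV[R]_n :=
  [set y | enorm (y - x) < r].

Definition qform n (A : 'M[R]_n) (x : 'cV[R]_n) : R := (x^T *m A *m x) 0 0.

(* R^u x R^s is identified with R^(u + s) by stacking column vectors. *)
Definition col_prod u s (X : set 'cV[R]_u) (Y : set 'cV[R]_s) :
    set 'cV[R]_(u + s) :=
  [set col_mx x y | x in X & y in Y].

End Norms.

Section Derivative.
Context {R : realType} {n : nat}.
Implicit Types (F : 'cV[R]_n -> 'cV[R]_n) (p : 'cV[R]_n).

(* Row i, column j: the partial derivative of F_i with respect to p_j.
   The library's jacobian is for row vectors and is the transpose of this. *)
Definition Dmx F p : 'M[R]_n :=
  \matrix_(i, j) 'D_(delta_mx j 0) (fun q => F q i 0 : R) p.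

Definition C1_on (O : set 'cV[R]_n) F : Prop :=
  forall p, O p -> differentiable F p /\ {for p, continuous (Dmx F)}.

Definition deriv_enclosure (N : set 'cV[R]_n) F : set 'M[R]_n :=
  [set A | forall i j,
    A i j \in `[inf [set Dmx F p i j | p in N], sup [set Dmx F p i j | p in N]]].

End Derivative.

Section IntervalMatrix.
Context {R : realType}.

Definition interval_matrix m n (X : set 'M[R]_(m, n)) : Prop :=
  exists lo hi : 'M[R]_(m, n),
    (forall i j, lo i j <= hi i j) /\
    X = [set A | forall i j, A i j \in `[lo i j, hi i j]].

Definition block_set u s (A : set 'M[R]_u) (E1 : set 'M[R]_(u, s))
    (E2 : set 'M[R]_(s, u)) (B : set 'M[R]_s) : set 'M[R]_(u + s) :=
  [set P | [/\ A (ulsubmx P), E1 (ursubmx P), E2 (dlsubmx P) & B (drsubmx P)]].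

End IntervalMatrix.

Section Flow.
Context {R : realType} {n : nat}.
Context (O : set 'cV[R]_n) (F : 'cV[R]_n -> 'cV[R]_n).

(* x is an integral curve of F, as a vector field on O, starting at p. *)
Definition integral_curve (a b : R) (p : 'cV[R]_n) (x : R -> 'cV[R]_n) : Prop :=
  [/\ 0 \in `]a, b[, x 0 = p &
      forall t, t \in `]a, b[ -> O (x t) /\ is_derive t 1 x (F (x t))].

(* The values at time t of the integral curves through p; at most one when F is
   C^1 on the open set O. *)
Definition flow_values (t : R) (p : 'cV[R]_n) : set 'cV[R]_n :=
  [set q | exists a b x,
    [/\ integral_curve a b p x, t \in `]a, b[ & x t = q]].

Definition flow_defined (t : R) (p : 'cV[R]_n) : Prop :=
  flow_values t p !=set0.

(* phi_t(p), with junk value 0 when the flow is not defined at (t, p). *)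
Definition flow (t : R) (p : 'cV[R]_n) : 'cV[R]_n := xget 0 (flow_values t p).

Definition strong_stable (lambda : R) (V : set 'cV[R]_n) : set 'cV[R]_n :=
  [set p |
    (forall t, 0 <= t -> flow_defined t p /\ V (flow t p)) /\
    (exists2 C : R, 0 < C &
      forall t, 0 <= t -> enorm (flow t p) <= C * expR (t * lambda))].

End Flow.

(* Main.v *)
Require Import Defs.
From HB Require Import structures.
From mathcomp Require Import all_boot all_order all_algebra.
From mathcomp Require Import all_classical all_reals all_analysis.
From mathcomp Require Import ring lra.

Set Implicit Arguments.
Unset Strict Implicit.
Unset Printing Implicit Defensive.

Import Order.TTheory GRing.Theory Num.Theory.
Import numFieldNormedType.Exports.

Local Open Scope classical_set_scope.
Local Open Scope ring_scope.

(** Write z = (x, y) and let cone k z = |x|^2 - k |y|^2.  If P is a block matrix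
satisfying the first and third (resp. second and fourth) inequalities of the
hypothesis, then Cauchy-Schwarz and Young turn them into
[c * cone k z < <grad(cone k) z, P z> / 2] for z <> 0, with k = 1 / alpha_h and
c = c_h (resp. k = alpha_v and c = c_v) (cone_condition).  By the mean value
theorem DF(q) at a single point q computes this pairing for F p1 - F p2, so along
the difference of two trajectories in N the function cone k grows at least like
exp(2 c t) (cone_growth).  Two consequences:

- if p1 and p2 are in the strong stable set, then cone alpha_v (p1 - p2) <= 0:
  otherwise the difference would grow like exp(c_v t), whereas it decays like
  exp(c_h t) and c_h < c_v (strong_stable_cone).  So the strong stable set is the
  graph of a function with Lipschitz constant sqrt alpha_v over its projection;

- a trajectory that stays in N and in the cone { cone alpha_v <= 0 } decays like
  exp(c_h t), because - cone (1 / alpha_h) <= exp(2 c_h t) * constant and this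
  quantity controls |z|^2 on that cone, as alpha_v < 1 / alpha_h.

It remains to find, over every y with |y|^2 <= 1 - alpha_h, a point whose
trajectory exists forever and stays in N and in that cone.  Replace the flow by the
Euler map Phi = id + h F, for which the cone inequalities survive when h is small:
compactness of N gives them a uniform margin (cone_slack) that absorbs the terms of
order h^2 (cone_euler_step).  The preimage under Phi of a Lipschitz graph x = w(y) is
the graph of the solution of x = w(y + h F_y(x, y)) - h F_x(x, y), a contraction in x;
its Lipschitz constant is again at most sqrt alpha_v, because Phi preserves the
inequality cone alpha_v > 0 between two points (graph_transform).  Pulling the graph
x = 0 back m times gives points with m Euler steps in N and in the cone:
|x| <= sqrt alpha_v there, and the inequality 1 - 1 / alpha_h <= cone (1 / alpha_h),
which says |y|^2 <= 1 - alpha_h + alpha_h |x|^2, propagates along the orbit and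
prevents |y| from exceeding 1 (graph_transform_orbit).
Finally h tends to 0 and the number of steps times h to infinity; the Euler orbits
converge along an ultrafilter to a trajectory on [0, +oo[ (euler_limit).

The curves defining the flow live on open intervals of times in O.  A short
backward piece is again a limit of Euler orbits (backward_curve), and uniqueness
of curves identifies the limit trajectory with the flow (integral_curve_flow). *)

(** * Euclidean norm and operator norm *)

Lemma near_norm_le (R : realType) (V : normedModType R) (x : V) (e : R) :
  0 < e -> \forall y \near x, `|x - y| <= e.
Proof.
move=> e0; apply/nbhs_ballP; exists e => //= y.
by rewrite -ball_normE => /ltW.
Qed.

Lemma lipschitz_within_continuous (R : realType) (V W : normedModType R) (A : set V)
    (f : V -> W) (C : R) :
  (forall x y, A x -> A y -> `|f x - f y| <= C * `|x - y|) ->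
  {within A, continuous f}.
Proof.
move=> fC; apply/subspace_continuousP => x Ax; apply/cvgrPdist_le => e e0.
have C1 : 0 < `|C| + 1 by rewrite ltr_wpDl.
have : \forall y \near x, `|x - y| <= e / (`|C| + 1).
  by apply: near_norm_le; rewrite divr_gt0.
apply: filterS => y h Ay.
apply: le_trans (fC x y Ax Ay) _.
apply: le_trans (_ : (`|C| + 1) * `|x - y| <= _).
  by rewrite ler_wpM2r// (le_trans (ler_norm _))// lerDl.
by rewrite mulrC -ler_pdivlMr.
Qed.

Lemma lipschitz_norm_continuous (R : realType) (V W : normedModType R)
    (f : V -> W) (C : R) :
  (forall x y, `|f x - f y| <= C * `|x - y|) -> continuous f.
Proof.
move=> fC; apply/continuous_subspace_setT.
by apply: (@lipschitz_within_continuous _ _ _ _ _ C) => x y _ _; exact: fC.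
Qed.

(** Signed weights let one bilinear form serve both for the Euclidean inner product
and for the indefinite quadratic forms that define the cones. *)
Section WeightedDot.
Context {R : realType} {n : nat}.
Implicit Types (sg : 'I_n -> R) (x y z : 'cV[R]_n).

Definition wdot sg x y : R := \sum_i sg i * (x i 0 * y i 0).

Lemma wdotC sg x y : wdot sg x y = wdot sg y x.
Proof. by apply: eq_bigr => i _; rewrite (mulrC (x i 0)). Qed.

Lemma wdotDl sg x y z : wdot sg (x + y) z = wdot sg x z + wdot sg y z.
Proof.
by rewrite -big_split; apply: eq_bigr => i _ /=; rewrite mxE mulrDl mulrDr.
Qed.

Lemma wdotZl sg (a : R) x z : wdot sg (a *: x) z = a * wdot sg x z.
Proof. by rewrite mulr_sumr; apply: eq_bigr => i _; rewrite mxE; ring. Qed.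

Lemma wdotNl sg x z : wdot sg (- x) z = - wdot sg x z.
Proof. by rewrite -scaleN1r wdotZl mulN1r. Qed.

Lemma wdotBl sg x y z : wdot sg (x - y) z = wdot sg x z - wdot sg y z.
Proof. by rewrite wdotDl wdotNl. Qed.

Lemma wdotDr sg x y z : wdot sg z (x + y) = wdot sg z x + wdot sg z y.
Proof. by rewrite wdotC wdotDl !(wdotC _ z). Qed.

Lemma wdotZr sg (a : R) x z : wdot sg z (a *: x) = a * wdot sg z x.
Proof. by rewrite wdotC wdotZl (wdotC _ z). Qed.

Lemma wdotBr sg x y z : wdot sg z (x - y) = wdot sg z x - wdot sg z y.
Proof. by rewrite wdotC wdotBl !(wdotC _ z). Qed.

End WeightedDot.

Definition edot {R : realType} {n : nat} (x y : 'cV[R]_n) : R :=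
  wdot (fun=> 1) x y.

Section Euclidean.
Context {R : realType}.

Lemma enorm_ge0 n (x : 'cV[R]_n) : 0 <= enorm x.
Proof. exact: sqrtr_ge0. Qed.

Lemma enorm_sqr n (x : 'cV[R]_n) : enorm x ^+ 2 = edot x x.
Proof.
rewrite sqr_sqrtr; last by apply: sumr_ge0 => i _; exact: sqr_ge0.
by apply: eq_bigr => i _; rewrite mul1r expr2.
Qed.

Lemma enormE n (x : 'cV[R]_n) : enorm x = Num.sqrt (edot x x).
Proof. by rewrite -enorm_sqr sqrtr_sqr ger0_norm // enorm_ge0. Qed.

Lemma enormZ n (a : R) (x : 'cV[R]_n) : enorm (a *: x) = `|a| * enorm x.
Proof.
rewrite !enormE /edot wdotZl wdotZr mulrA -expr2 sqrtrM ?sqr_ge0//.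
by rewrite sqrtr_sqr.
Qed.

Lemma enormN n (x : 'cV[R]_n) : enorm (- x) = enorm x.
Proof. by rewrite -scaleN1r enormZ normrN normr1 mul1r. Qed.

Lemma enorm_distC n (x y : 'cV[R]_n) : enorm (x - y) = enorm (y - x).
Proof. by rewrite -enormN opprB. Qed.

Lemma enorm0 n : enorm (0 : 'cV[R]_n) = 0.
Proof. by rewrite -(scale0r 0) enormZ normr0 mul0r. Qed.

Lemma enorm_eq0 n (x : 'cV[R]_n) : enorm x = 0 -> x = 0.
Proof.
move=> x0; have : edot x x == 0 by rewrite -enorm_sqr x0 expr0n.
rewrite psumr_eq0 => [/allP xi|i _]; last by rewrite mul1r -expr2 sqr_ge0.
apply/colP => i; rewrite mxE; apply/eqP.
by have := xi i (mem_index_enum i); rewrite mul1r mulf_eq0 orbb.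
Qed.

(** The square of the norm of |y|^2 x - <x, y> y is |y|^2 (|x|^2 |y|^2 - <x, y>^2). *)
Lemma edot_CS n (x y : 'cV[R]_n) : `|edot x y| <= enorm x * enorm y.
Proof.
have [y0|yn0] := eqVneq (enorm y) 0.
  have -> := enorm_eq0 y0.
  by rewrite /edot -(scale0r 0) wdotZr mul0r normr0 mulr_ge0 ?enorm_ge0.
have y2 : 0 < edot y y by rewrite -enorm_sqr exprn_gt0// lt_def yn0 enorm_ge0.
have : 0 <= edot (edot y y *: x - edot x y *: y) (edot y y *: x - edot x y *: y).
  by rewrite -enorm_sqr sqr_ge0.
rewrite {1}/edot wdotBl !wdotBr !wdotZl !wdotZr -!/(edot _ _).
rewrite (_ : edot y x = edot x y); last exact: wdotC.
rewrite (_ : _ - _ = edot y y * (edot x x * edot y y - edot x y ^+ 2)); last ring.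
rewrite pmulr_rge0// subr_ge0 => h.
rewrite -(@ler_pXn2r _ 2)// ?nnegrE ?mulr_ge0 ?enorm_ge0//.
by rewrite exprMn !enorm_sqr real_normK// num_real.
Qed.

Lemma ler_enormD n (x y : 'cV[R]_n) : enorm (x + y) <= enorm x + enorm y.
Proof.
rewrite -(@ler_pXn2r _ 2)// ?nnegrE ?addr_ge0 ?enorm_ge0//.
rewrite sqrrD !enorm_sqr {1}/edot wdotDl !wdotDr -!/(edot _ _).
rewrite (_ : edot y x = edot x y); last exact: wdotC.
have := le_trans (ler_norm _) (edot_CS x y).
by rewrite mulr2n; lra.
Qed.

Lemma ler_enormB n (x y : 'cV[R]_n) : enorm (x - y) <= enorm x + enorm y.
Proof. by rewrite -(enormN y) ler_enormD. Qed.

Lemma ler_dist_enorm n (x y : 'cV[R]_n) : `|enorm x - enorm y| <= enorm (x - y).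
Proof.
rewrite ler_norml; have := ler_enormD (x - y) y; have := ler_enormD (y - x) x.
by rewrite !subrK (enorm_distC y); lra.
Qed.

Lemma coord_le_enorm n (x : 'cV[R]_n) i : `|x i 0| <= enorm x.
Proof.
rewrite -(@ler_pXn2r _ 2)// ?nnegrE ?enorm_ge0//.
rewrite enorm_sqr real_normK ?num_real// /edot /wdot (bigD1 i)//= mul1r -expr2.
by rewrite lerDl sumr_ge0// => j _; rewrite mul1r -expr2 sqr_ge0.
Qed.

Lemma mx_norm_le_enorm n (x : 'cV[R]_n) : `|x| <= enorm x.
Proof.
rewrite /Num.Def.normr/= mx_normrE; apply: bigmax_le; first exact: enorm_ge0.
by move=> [i j] _ /=; rewrite ord1 coord_le_enorm.
Qed.

Lemma coord_le_mx_norm m n (A : 'M[R]_(m, n)) i j : `|A i j| <= `|A|.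
Proof.
by rewrite [leRHS]/Num.Def.normr/= mx_normrE; exact: (le_bigmax _ _ (i, j)).
Qed.

Lemma enorm_le_mx_norm n (x : 'cV[R]_n) : enorm x <= n%:R * `|x|.
Proof.
rewrite -(@ler_pXn2r _ 2)// ?nnegrE ?mulr_ge0 ?enorm_ge0//.
rewrite enorm_sqr exprMn; apply: (@le_trans _ _ (n%:R * `|x| ^+ 2)); last first.
  by rewrite ler_wpM2r ?sqr_ge0// -natrX ler_nat; case: (n) => // k; rewrite expnS leq_pmulr.
rewrite mulr_natl -[X in _ *+ X]card_ord -sumr_const; apply: ler_sum => i _.
rewrite mul1r -expr2 -real_normK ?num_real// ler_pXn2r ?nnegrE//.
exact: coord_le_mx_norm.
Qed.

Lemma enorm_continuous n : continuous (@enorm R n).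
Proof.
apply: (@lipschitz_norm_continuous _ _ _ _ n%:R) => x y.
exact: le_trans (ler_dist_enorm _ _) (enorm_le_mx_norm _).
Qed.

Lemma closure_eball n (r : R) : 0 < r ->
  closure (eball (0 : 'cV[R]_n) r) = [set x | enorm x <= r].
Proof.
move=> r0; apply/seteqP; split => x.
  have : closed [set x : 'cV[R]_n | enorm x <= r].
    apply: (@closed_comp _ _ (@enorm R n) [set t | t <= r]).
      by move=> ? _; exact: enorm_continuous.
    exact: closed_le.
  move/closure_id => -> /=; apply: closure_subset => y /=.
  by rewrite /eball/= subr0 => /ltW.
move=> /= xr B /nbhs_ballP[e /= e0 eB].
have [x0|xn0] := eqVneq (enorm x) 0.
  exists x; split; first by rewrite /eball/= subr0 x0.
  by apply: eB; exact: ballxx.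
have x0 : 0 < enorm x by rewrite lt_def xn0 enorm_ge0.
pose d := Num.min 1 (e / (2 * enorm x)).
have d0 : 0 < d by rewrite lt_min ltr01/= divr_gt0// mulr_gt0.
have d1 : d <= 1 by rewrite ge_min lexx.
have de : d <= e / (2 * enorm x) by rewrite ge_min lexx orbT.
exists ((1 - d) *: x); split.
  rewrite /eball/= subr0 enormZ ger0_norm ?subr_ge0//.
  apply: lt_le_trans xr; rewrite mulrBl mul1r ltrBlDr ltrDl mulr_gt0//.
apply: eB; rewrite -ball_normE/=.
rewrite -[X in X - _]scale1r -scalerBl opprB addrC subrK normrZ (gtr0_norm d0).
apply: le_lt_trans (_ : d * enorm x < e).
  by rewrite ler_wpM2l ?(ltW d0)// mx_norm_le_enorm.
apply: le_lt_trans (ler_wpM2r (ltW x0) de) _.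
rewrite invfM mulrA divfK//; rewrite ltr_pdivrMr//; lra.
Qed.

Lemma compact_enorm_le n (r : R) : compact [set x : 'cV[R]_n | enorm x <= r].
Proof.
have tc : {within [set v : 'rV[R]_n | forall i, v ord0 i \in `[- r, r]],
    continuous (fun v : 'rV[R]_n => v^T)}.
  apply: continuous_subspaceT.
  apply: (@lipschitz_norm_continuous _ _ _ _ 1) => v w; rewrite mul1r.
  rewrite -linearB /= [leLHS]/Num.Def.normr/= mx_normrE; apply: bigmax_le => //.
  by move=> [i j] _ /=; rewrite mxE; exact: coord_le_mx_norm.
have ck : compact [set v : 'rV[R]_n | forall i, v ord0 i \in `[- r, r]].
  apply: (@rV_compact _ _ (fun=> `[- r, r]%classic)).
  by move=> _; exact: segment_compact.
apply: subclosed_compact (continuous_compact tc ck) _.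
  apply: (@closed_comp _ _ (@enorm R n) [set t | t <= r]).
    by move=> ? _; exact: enorm_continuous.
  exact: closed_le.
move=> x /= xr; exists x^T; last exact: trmxK.
move=> i; rewrite mxE in_itv/= -ler_norml.
exact: le_trans (coord_le_enorm _ _) xr.
Qed.

Lemma enorm_mulmx_le m n (A : 'M[R]_(m, n)) (C : R) (x : 'cV[R]_n) :
  0 <= C -> (forall i j, `|A i j| <= C) ->
  enorm (A *m x) <= m%:R * (n%:R * C) * enorm x.
Proof.
move=> C0 AC; apply: le_trans (enorm_le_mx_norm _) _; rewrite -!mulrA ler_wpM2l//.
rewrite [leLHS]/Num.Def.normr/= mx_normrE; apply: bigmax_le => [|[i j] _ /=].
  by rewrite !mulr_ge0// enorm_ge0.
rewrite mxE; apply: le_trans (ler_norm_sum _ _ _) _.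
rewrite mulr_natl -[X in _ *+ X]card_ord -sumr_const; apply: ler_sum => k _.
by rewrite normrM ler_pM// ord1 coord_le_enorm.
Qed.

Lemma opnorm_ub m n (A : 'M[R]_(m, n)) (x : 'cV[R]_n) :
  enorm x <= 1 -> enorm (A *m x) <= opnorm A.
Proof.
move=> x1; apply: ub_le_sup; last by exists x.
exists (m%:R * (n%:R * `|A|)) => _ [y /= y1 <-].
apply: le_trans (enorm_mulmx_le _ (normr_ge0 _) (coord_le_mx_norm A)) _.
by rewrite -[leRHS]mulr1 ler_wpM2l// !mulr_ge0.
Qed.

Lemma opnorm_ge0 m n (A : 'M[R]_(m, n)) : 0 <= opnorm A.
Proof.
apply: le_trans (opnorm_ub A (_ : enorm 0 <= 1)); first exact: enorm_ge0.
by rewrite enorm0.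
Qed.

Lemma enorm_mulmx_opnorm m n (A : 'M[R]_(m, n)) (x : 'cV[R]_n) :
  enorm (A *m x) <= opnorm A * enorm x.
Proof.
have [->|xn0] := eqVneq x 0; first by rewrite mulmx0 !enorm0 mulr0.
have x0 : 0 < enorm x.
  by rewrite lt_def enorm_ge0 andbT; apply: contra_neq xn0 => /enorm_eq0.
rewrite -ler_pdivrMr// mulrC -[X in X * _]ger0_norm ?invr_ge0 ?enorm_ge0//.
rewrite -enormZ scalemxAr opnorm_ub// enormZ ger0_norm ?invr_ge0 ?enorm_ge0//.
by rewrite mulVf// gt_eqF.
Qed.

Lemma coord_le_opnorm m n (A : 'M[R]_(m, n)) i j : `|A i j| <= opnorm A.
Proof.
have := enorm_mulmx_opnorm A (delta_mx j 0).
have -> : enorm (delta_mx j 0 : 'cV[R]_n) = 1.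
  rewrite enormE /edot /wdot (bigD1 j)//= big1 => [|k kj]; last first.
    by rewrite mxE (negbTE kj) mulr0 mulr0.
  by rewrite mxE !eqxx !mulr1 addr0 sqrtr1.
rewrite mulr1 => /(le_trans _); apply.
by rewrite -colE; have := coord_le_enorm (col j A) i; rewrite mxE.
Qed.

End Euclidean.

(** * Mean value theorem and exponential growth *)

Section Derivatives.
Context {R : realType}.

Lemma differential_Dmx n (F : 'cV[R]_n -> 'cV[R]_n) p d i :
  differentiable F p ->
  'd (fun q => F q i 0 : R) p d = (Dmx F p *m d) i 0.
Proof.
move=> dF.
have dFi : differentiable (fun q => F q i 0 : R) p.
  apply: (@differentiable_comp _ _ _ _ F (fun M : 'cV[R]_n => M i 0 : R)) => //.
  exact: differentiable_coord.
rewrite {1}(_ : d = \sum_j d j 0 *: delta_mx j 0); last first.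
  apply/colP => k; rewrite summxE (bigD1 k)//= !mxE !eqxx mulr1 big1 ?addr0//.
  by move=> j jk; rewrite !mxE eq_sym (negbTE jk) mulr0.
rewrite linear_sum /= mxE; apply: eq_bigr => j _.
by rewrite linearZ/= mxE [RHS]mulrC deriveE.
Qed.

Lemma is_derive_coord_line n (F : 'cV[R]_n -> 'cV[R]_n) q d i (t : R) :
  differentiable F (q + t *: d) ->
  is_derive t 1 (fun t : R => F (q + t *: d) i 0 : R)
    ((Dmx F (q + t *: d) *m d) i 0).
Proof.
move=> dF.
pose g := fun t : R => q + t *: d.
have dg : is_diff t g ( *:%R^~ d).
  by apply: is_diff_eq; rewrite add0r.
have dFi : differentiable (fun q => F q i 0 : R) (g t).
  apply: (@differentiable_comp _ _ _ _ F (fun M : 'cV[R]_n => M i 0 : R)) => //.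
  exact: differentiable_coord.
have dc : differentiable ((fun q => F q i 0 : R) \o g) t.
  by apply: differentiable_comp => //; exact: ex_diff.
apply: DeriveDef; first exact: diff_derivable dc.
rewrite deriveE// -(differential_Dmx _ _ dF).
rewrite (_ : (fun t : R => _) = (fun q => F q i 0 : R) \o g)//.
by rewrite diff_comp//= diff_val scale1r.
Qed.

Lemma is_derive_wdot n sg (x y : R -> 'cV[R]_n) x' y' (t : R) :
  is_derive t 1 x x' -> is_derive t 1 y y' ->
  is_derive t 1 (fun t => wdot sg (x t) (y t)) (wdot sg x' (y t) + wdot sg (x t) y').
Proof.
have dcoord (z : R -> 'cV[R]_n) z' (i : 'I_n) : is_derive t 1 z z' ->
    is_derive t 1 (fun t => z t i 0 : R) (z' i 0).
  move=> [dz <-]; apply: DeriveDef; first exact: (derivable_mxP _ _ _).1.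
  by rewrite derive_mx// mxE.
move=> dx dy.
rewrite (_ : (fun t => _) = \sum_(i < n) (fun t => sg i * (x t i 0 * y t i 0))); last first.
  by apply/funext => r; rewrite fct_sumE.
have dsum i : is_derive t 1 (fun t => sg i * (x t i 0 * y t i 0))
   (sg i * (x' i 0 * y t i 0) + sg i * (x t i 0 * y' i 0)).
  have dxi := dcoord _ _ i dx; have dyi := dcoord _ _ i dy.
  have dm := is_deriveM dxi dyi.
  have := is_deriveZ (sg i) dm.
  move=> /is_derive_eq; apply; rewrite -!mulrDr; congr (_ * _).
  by rewrite addrC [X in X + _]mulrC.
have := is_derive_sum dsum.
by move=> /is_derive_eq; apply; rewrite -big_split.
Qed.

Lemma is_derive_wdot_line n sg v (F : 'cV[R]_n -> 'cV[R]_n) q d (t : R) :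
  differentiable F (q + t *: d) ->
  is_derive t 1 (fun t : R => wdot sg v (F (q + t *: d)))
    (wdot sg v (Dmx F (q + t *: d) *m d)).
Proof.
move=> dF.
rewrite (_ : (fun t => _) =
    \sum_(i < n) (fun t => sg i * (v i 0 * F (q + t *: d) i 0))); last first.
  by apply/funext => r; rewrite fct_sumE.
have dsum i : is_derive t 1 (fun t : R => sg i * (v i 0 * F (q + t *: d) i 0))
   (sg i * (v i 0 * (Dmx F (q + t *: d) *m d) i 0)).
  have := is_deriveZ (sg i) (is_deriveZ (v i 0) (is_derive_coord_line i dF)).
  by move=> /is_derive_eq; apply.
exact: is_derive_sum dsum.
Qed.

(** Pairing with a fixed vector reduces to the scalar mean value theorem, so the
Jacobian at a single point represents the increment of F. *)
Lemma wdot_mvt n sg v (F : 'cV[R]_n -> 'cV[R]_n) p q :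
  (forall t : R, 0 <= t <= 1 -> differentiable F (q + t *: (p - q))) ->
  exists2 t : R, 0 <= t <= 1 &
    wdot sg v (F p - F q) = wdot sg v (Dmx F (q + t *: (p - q)) *m (p - q)).
Proof.
move=> dF; pose f (t : R) := wdot sg v (F (q + t *: (p - q))).
have df (t : R) : 0 <= t <= 1 -> is_derive t 1 f
    (wdot sg v (Dmx F (q + t *: (p - q)) *m (p - q))).
  by move=> /dF; exact: is_derive_wdot_line.
have [||c c01] := @MVT_segment R f
    (fun t => wdot sg v (Dmx F (q + t *: (p - q)) *m (p - q))) 0 1 ler01.
- by move=> t; rewrite in_itv/= => /andP[t0 t1]; apply: df; rewrite !ltW.
- apply: derivable_within_continuous => t; rewrite in_itv/= => /df dft.
  by case: dft.
rewrite /f scale1r scale0r addr0 [q + _]addrC subrK subr0 mulr1 -wdotBr => ->.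
by exists c.
Qed.

(** The derivative of exp(- c t) q(t) is nonnegative. *)
Lemma exp_growth (q dq : R -> R) (c a b : R) : a <= b ->
  (forall t, a <= t <= b -> is_derive t 1 q (dq t)) ->
  (forall t, a <= t <= b -> c * q t <= dq t) ->
  expR (c * (b - a)) * q a <= q b.
Proof.
move=> ab Dq cq; pose f (t : R) := expR (- c * t) * q t.
have df (t : R) : a <= t <= b -> is_derive t 1 f (expR (- c * t) * (dq t - c * q t)).
  move=> /Dq dqt.
  have de : is_derive t 1 (fun t => expR (- c * t)) (- c * expR (- c * t)).
    have dl : is_derive t 1 (fun t : R => - c * t) (- c).
      by have := is_deriveZ (- c) (is_derive_id t 1); move=> /is_derive_eq; apply; rewrite /GRing.scale/= mulr1.
    by have := is_derive1_comp (is_derive_expR _) dl; move=> /is_derive_eq; apply; rewrite mulrC.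
  have := is_deriveM de dqt; move=> /is_derive_eq; apply.
  by rewrite /GRing.scale/=; ring.
have fab : f a <= f b.
  apply: (@ger0_derive1_ndecr R f a b) => // [t|t|].
  - by rewrite in_itv/= => /andP[/ltW at0 /ltW tb]; have [] := df t; rewrite ?at0.
  - rewrite in_itv/= => /andP[/ltW at0 /ltW tb].
    have [|_ ft] := df t; first by rewrite at0.
    rewrite derive1E ft mulr_ge0 ?expR_ge0// subr_ge0 cq// at0 tb//.
  - apply: derivable_within_continuous => t; rewrite in_itv/= => /df dft.
    by case: dft.
have := ler_wpM2l (expR_ge0 (c * b)) fab.
by rewrite /f !mulrA -!expRD !mulNr subrr expR0 mul1r mulrBr.
Qed.

End Derivatives.

(** * Limits of Euler orbits *)

Section EulerLimit.
Context {R : realType} {V : normedModType R}.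

Definition euler (h : R) (F : V -> V) (z : V) (k : nat) : V :=
  iter k (fun w => w + h *: F w) z.

Lemma eulerS h F z k : euler h F z k.+1 = euler h F z k + h *: F (euler h F z k).
Proof. by []. Qed.

Section Estimates.
Variables (K : set V) (F : V -> V) (L m h : R) (z : V).
Hypotheses (L0 : 0 <= L) (m0 : 0 <= m) (h0 : 0 <= h).
Hypothesis FL : forall p q, K p -> K q -> `|F p - F q| <= L * `|p - q|.
Hypothesis Fm : forall p, K p -> `|F p| <= m.

Lemma euler_speed i k : (forall j, (j < k)%N -> K (euler h F z (i + j))) ->
  `|euler h F z (i + k) - euler h F z i| <= m * (h * k%:R).
Proof.
elim: k => [|k IH] Kz; first by rewrite addn0 subrr normr0 !mulr0.
rewrite addnS eulerS addrAC; apply: le_trans (ler_normD _ _) _.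
apply: le_trans (lerD (IH _) (_ : _ <= m * h)) _.
- by move=> j jk; apply: Kz; exact: ltnW.
- by rewrite normrZ (ger0_norm h0) mulrC ler_wpM2r// Fm//; exact: Kz.
- by rewrite -natr1; lra.
Qed.

(** The increments F(z_j) - F(z_i) are of order h (j - i) by euler_speed, and k of
them are summed with weight h.  The bound depends on h k only, which is what makes
it survive the limit of vanishing steps. *)
Lemma euler_second_order i k : (forall j, (j <= k)%N -> K (euler h F z (i + j))) ->
  `|euler h F z (i + k) - euler h F z i - (h * k%:R) *: F (euler h F z i)|
    <= L * m * (h * k%:R) ^+ 2.
Proof.
elim: k => [|k IH] Kz.
  by rewrite addn0 subrr mulr0 scale0r subr0 normr0 expr0n mulr0.
have -> : euler h F z (i + k.+1) - euler h F z i
    - (h * k.+1%:R) *: F (euler h F z i) =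
  (euler h F z (i + k) - euler h F z i - (h * k%:R) *: F (euler h F z i))
  + h *: (F (euler h F z (i + k)) - F (euler h F z i)).
  rewrite addnS eulerS -natr1 mulrDr mulr1 scalerDl scalerBr opprD.
  by rewrite !addrA; congr (_ - _); rewrite [RHS]addrAC; congr (_ - _); rewrite addrAC.
apply: le_trans (ler_normD _ _) _.
apply: le_trans (lerD (IH _) (_ : _ <= h * (L * (m * (h * k%:R))))) _.
- by move=> j jk; apply: Kz; exact: leqW.
- rewrite normrZ (ger0_norm h0) ler_wpM2l//.
  have Ki : K (euler h F z i) by have := Kz 0%N isT; rewrite addn0.
  apply: le_trans (FL (Kz _ (leqnSn k)) Ki) _; rewrite ler_wpM2l//.
  by apply: euler_speed => j jk; apply: Kz; rewrite ltnW// ltnW.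
- rewrite -natr1.
  have : 0 <= L * m * (h ^+ 2 * (k%:R + 1)).
    by rewrite !mulr_ge0// ?sqr_ge0// addr_ge0.
  lra.
Qed.

End Estimates.

Lemma ultra_map (T U : Type) (f : T -> U) (G : set_system T) :
  UltraFilter G -> UltraFilter (f @ G).
Proof.
move=> GU; split; first exact: fmap_proper_filter.
move=> H PH sGH; apply/seteqP; split => // A HA.
have [//|GnA] := in_ultra_setVsetC (f @^-1` A) GU.
have HnA : H (~` A) by apply: sGH.
by have [? []] := @filter_ex _ _ PH _ (@filterI _ _ PH _ _ HA HnA).
Qed.

(** Along an ultrafilter the orbits converge at every time at once, by compactness of K;
this replaces a diagonal subsequence.  The second-order consistency of the
Euler orbits passes to the limit and contains both continuity and the differential
equation.  The set I of times is the whole line for global orbits and a bounded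
interval for the backward pieces of integral curves. *)
Lemma euler_limit (K : set V) (F : V -> V) (L m : R) (z0 : nat -> V) (I : set R) :
  compact K -> 0 <= L -> 0 <= m ->
  (forall p q, K p -> K q -> `|F p - F q| <= L * `|p - q|) ->
  (forall p, K p -> `|F p| <= m) ->
  (forall t, I t -> \forall n \near \oo, forall k, k%:R / n.+1%:R <= t ->
     K (euler n.+1%:R^-1 F (z0 n) k)) ->
  exists x : R -> V,
   [/\ forall t, 0 <= t -> I t -> K (x t),
       forall s t, 0 <= s -> 0 <= t -> I s -> I t ->
         `|x t - x s - (t - s) *: F (x s)| <= 2 * (L * m) * (t - s) ^+ 2 &
       forall C, closed C -> I 0 -> (forall n, C (z0 n)) -> C (x 0)].
Proof.
move=> cK L0 m0 FL Fm KI.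
have [U [UU ooU]] := ultraFilterLemma (@eventually_filter).
pose k (t : R) (n : nat) := Num.truncn (t * n.+1%:R).
have kle t n : 0 <= t -> (k t n)%:R / n.+1%:R <= t.
  move=> t0; rewrite ler_pdivrMr// /k.
  by have /andP[] := truncn_itv (mulr_ge0 t0 (ler0n R n.+1)).
pose y t n := euler n.+1%:R^-1 F (z0 n) (k t n).
have yK t : 0 <= t -> I t -> \forall n \near U, K (y t n).
  move=> t0 /KI It; apply: ooU; move: It; apply: filterS => n; apply.
  exact: kle.
have yx t : exists v, 0 <= t -> I t -> K v /\ y t n @[n --> U] --> v.
  have [t0|] := boolP (0 <= t); last by exists 0.
  have [It|nI] := pselect (I t); last by exists 0.
  have yU : UltraFilter (y t @ U) by exact: ultra_map.
  move: cK; rewrite compact_ultra => /(_ _ yU (yK t t0 It))[v [Kv yv]].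
  by exists v.
pose x t := sval (cid (yx t)).
have xK t : 0 <= t -> I t -> K (x t) by move=> t0 It; exact: (svalP (cid (yx t)) t0 It).1.
have yxcvg t : 0 <= t -> I t -> y t n @[n --> U] --> x t.
  by move=> t0 It; exact: (svalP (cid (yx t)) t0 It).2.
have kcvg t : 0 <= t -> (n.+1%:R^-1 * (k t n)%:R : R) @[n --> U] --> t.
  move=> t0; apply: (@cvg_trans _ ((n.+1%:R^-1 * (k t n)%:R : R) @[n --> \oo])).
    by apply: cvg_app => // A; exact: ooU.
  apply/cvgrPdist_le => e e0.
  have := @cvg_harmonic R; move/cvgrPdist_le => /(_ _ e0).
  apply: filterS => n; rewrite sub0r normrN /harmonic/= ger0_norm ?invr_ge0//.
  apply: le_trans; rewrite ger0_norm ?subr_ge0 1?mulrC ?kle//.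
  rewrite lerBlDl -[X in _ + X]mul1r -mulrDl ler_pdivlMr// natr1.
  by have /andP[_ /ltW] := truncn_itv (mulr_ge0 t0 (ler0n R n.+1)).
have Fcvg t : 0 <= t -> I t -> F (y t n) @[n --> U] --> F (x t).
  move=> t0 It; apply/cvgrPdist_le => e e0.
  have L1 : 0 < L + 1 by rewrite ltr_wpDl.
  have := yxcvg t t0 It; move/cvgrPdist_le => /(_ (e / (L + 1))).
  rewrite divr_gt0// => /(_ isT) yxe.
  have yKt := yK t t0 It.
  apply: filterS2 yxe yKt => n; rewrite ler_pdivlMr// => le Ky.
  apply: le_trans (FL _ _ (xK t t0 It) Ky) _; apply: le_trans le.
  by rewrite mulrC ler_wpM2l// lerDl.
have ks s t n : s <= t -> (k s n <= k t n)%N.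
  by move=> st; rewrite le_truncn// ler_wpM2r.
pose hh s t n : R := n.+1%:R^-1 * (k t n)%:R - n.+1%:R^-1 * (k s n)%:R.
have hhE s t n : s <= t -> hh s t n = n.+1%:R^-1 * (k t n - k s n)%N%:R.
  by move=> st; rewrite /hh -mulrBr natrB// ks.
have hcvg s t : 0 <= s -> 0 <= t -> hh s t n @[n --> U] --> t - s.
  by move=> s0 t0; apply: cvgB; exact: kcvg.
have h0 n : 0 <= n.+1%:R^-1 :> R by rewrite invr_ge0.
have sub s t n j : 0 <= t -> s <= t -> (j <= k t n - k s n)%N ->
    (k s n + j)%:R / n.+1%:R <= t.
  move=> t0 st jk; apply: le_trans (kle t n t0).
  by rewrite ler_wpM2r// ler_nat -(subnKC (ks s t n st)) leq_add2l.
have speed s t : 0 <= s -> s <= t -> I s -> I t -> `|x t - x s| <= m * (t - s).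
  move=> s0 st Is It; have t0 := le_trans s0 st.
  apply: (@ler_cvg_to _ U _ _
    (fun n => `|y t n - y s n|) (fun n => m * hh s t n)).
  + by apply: cvg_norm; apply: cvgB; exact: yxcvg.
  + by apply: cvgM; [exact: cvg_cst|exact: hcvg].
  + apply: ooU; move: (KI t It); apply: filterS => n Kn.
    rewrite hhE// /y -{1}(subnKC (ks s t n st)).
    apply: (@euler_speed K F m _ _ (h0 n) Fm) => j jk; apply: Kn.
    by apply: sub => //; exact: ltnW.
have quad s t : 0 <= s -> s <= t -> I s -> I t ->
    `|x t - x s - (t - s) *: F (x s)| <= L * m * (t - s) ^+ 2.
  move=> s0 st Is It; have t0 := le_trans s0 st.
  apply: (@ler_cvg_to _ U _ _
    (fun n => `|y t n - y s n - hh s t n *: F (y s n)|)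
    (fun n => L * m * (hh s t n) ^+ 2)).
  + apply: cvg_norm; apply: cvgB; last by apply: cvgZ; [exact: hcvg|exact: Fcvg].
    by apply: cvgB; exact: yxcvg.
  + apply: cvgM; first exact: cvg_cst.
    by rewrite expr2; under eq_fun do rewrite expr2; apply: cvgM; exact: hcvg.
  + apply: ooU; move: (KI t It); apply: filterS => n Kn.
    rewrite hhE// /y -{1}(subnKC (ks s t n st)).
    apply: (@euler_second_order K F L m _ _ L0 m0 (h0 n) FL Fm) => j jk; apply: Kn.
    exact: sub.
exists x; split => //.
- move=> s t s0 t0 Is It; have Lm0 := mulr_ge0 L0 m0.
  have [st|/ltW ts] := leP s t.
    apply: le_trans (quad s t s0 st Is It) _; rewrite ler_wpM2r ?sqr_ge0//; lra.
  (* exchange the base point: the two expansions differ by (s - t) (F x_s - F x_t) *)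
  rewrite (_ : _ - _ = - (x s - x t - (s - t) *: F (x t))
      + (s - t) *: (F (x s) - F (x t))); last first.
    rewrite scalerBr !opprD !opprK -(opprB s t) scaleNr opprK.
    by rewrite -!addrA addrCA; congr (_ + _); congr (_ + _); rewrite addrCA subrr addr0.
  apply: le_trans (ler_normD _ _) _; rewrite normrN.
  rewrite (_ : 2 * _ * _ = L * m * (s - t) ^+ 2 + L * m * (s - t) ^+ 2); last ring.
  apply: lerD; first exact: quad.
  rewrite normrZ ger0_norm ?subr_ge0//.
  have Fst := FL _ _ (xK s s0 Is) (xK t t0 It).
  have := speed t s t0 ts It Is; rewrite -subr_ge0 in ts.
  move=> /(ler_wpM2l L0)/(le_trans Fst)/(ler_wpM2l ts)/le_trans; apply.
  by rewrite le_eqVlt; apply/orP; left; apply/eqP; ring.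
- move=> C cC I0 Cz.
  have y0 n : y 0 n = z0 n by rewrite /y /k mul0r truncn0.
  apply: (@closed_cvg _ _ U _ (y 0) C) => //; last exact: yxcvg.
  by apply: filterE => n; rewrite y0.
Qed.

End EulerLimit.

(** * Uniqueness of integral curves *)

Section Flows.
Context {R : realType}.

Lemma quadratic_is_derive (V : normedModType R) (x : R -> V) (s : R) (v : V) (C : R) :
  (\forall t \near s, `|x t - x s - (t - s) *: v| <= C * (t - s) ^+ 2) ->
  is_derive s 1 x v.
Proof.
move=> /nbhs_ballP[d /= d0 xd].
have cv : h^-1 *: (x (h *: (1 : R) + s) - x s) @[h --> 0^'] --> v.
  apply/cvgrPdist_le => e e0.
  have C1 : 0 < `|C| + 1 by rewrite ltr_wpDl.
  near=> h.
  have hn0 : h != 0 by near: h; exact: nbhs_dnbhs_neq.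
  have hd : `|h| < d by near: h; exact: dnbhs0_lt.
  have he : `|h| <= e / (`|C| + 1).
    by near: h; apply: dnbhs0_le; rewrite divr_gt0.
  have := xd (h + s); rewrite -ball_normE/= opprD addrCA subrr addr0 normrN.
  move=> /(_ hd); rewrite addrK => hq.
  rewrite -normrN opprB.
  have -> : h^-1 *: (x (h *: (1 : R) + s) - x s) - v =
      h^-1 *: (x (h + s) - x s - h *: v).
    by rewrite [RHS]scalerBr scalerA mulVf// scale1r [h *: (1 : R)]mulr1.
  rewrite normrZ normfV ler_pdivrMl ?normr_gt0//.
  apply: le_trans hq _.
  rewrite -(real_normK (num_real h)) expr2 mulrA mulrC ler_wpM2l//.
  apply: le_trans (_ : (`|C| + 1) * `|h| <= _).
    by rewrite ler_wpM2r// (le_trans (ler_norm _))// lerDl.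
  by rewrite mulrC -ler_pdivlMr.
apply: DeriveDef; last exact: cvg_lim cv.
by apply/cvg_ex; exists v.
Unshelve. all: by end_near. Qed.

Lemma is_derive_continuous (V : normedModType R) (x : R -> V) (s : R) (v : V) :
  is_derive s 1 x v -> {for s, continuous x}.
Proof. by case=> dx _; apply/differentiable_continuous/derivable1_diffP. Qed.

(** The mean value theorem paired with v = F p - F q itself bounds |v|^2. *)
Lemma lipschitz_on_segment n (F : 'cV[R]_n -> 'cV[R]_n) p q (L : R) :
  (forall t : R, 0 <= t <= 1 -> differentiable F (q + t *: (p - q)) /\
     forall v, enorm (Dmx F (q + t *: (p - q)) *m v) <= L * enorm v) ->
  enorm (F p - F q) <= L * enorm (p - q).
Proof.
move=> dF.
have [t t01 eqF] := @wdot_mvt R n (fun=> 1) (F p - F q) F p q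
  (fun t t01 => (dF t t01).1).
have [->|vn0] := eqVneq (enorm (F p - F q)) 0.
  have := (dF t t01).2 (p - q); apply: le_trans; exact: enorm_ge0.
have v0 : 0 < enorm (F p - F q) by rewrite lt_def vn0 enorm_ge0.
rewrite -(ler_pM2l v0) -expr2 enorm_sqr /edot eqF.
apply: le_trans (ler_norm _) _; apply: le_trans (edot_CS _ _) _.
by rewrite ler_pM2l//; exact: (dF t t01).2.
Qed.

Lemma C1_locally_lipschitz n (O : set 'cV[R]_n) F p : open O -> C1_on O F -> O p ->
  exists r L : R, [/\ 0 < r, 0 <= L, ball p r `<=` O &
    forall x y, ball p r x -> ball p r y ->
      enorm (F x - F y) <= L * enorm (x - y)].
Proof.
move=> oO C1 Op.
have [r1 /= r10 r1O] : nbhs_ball p O by apply/nbhs_ballP/open_nbhs_nbhs.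
have [r2 /= r20 r2D] : nbhs_ball p [set q | `|Dmx F p - Dmx F q| <= 1].
  apply/nbhs_ballP.
  by have /cvgrPdist_le := (C1 p Op).2; apply.
pose C := `|Dmx F p| + 1; pose L := n%:R * (n%:R * C).
have C0 : 0 <= C by rewrite addr_ge0.
exists (Num.min r1 r2), L; split.
- by rewrite lt_min r10.
- by rewrite !mulr_ge0.
- by move=> x px; apply: r1O; apply: le_ball px; rewrite ge_min lexx.
move=> x y px py; apply: lipschitz_on_segment => t /andP[t0 t1].
have pt : ball p (Num.min r1 r2) (y + t *: (x - y)).
  move: px py; rewrite -ball_normE/= => px py.
  have -> : p - (y + t *: (x - y)) = (1 - t) *: (p - y) + t *: (p - x).
    rewrite scalerBl scale1r -addrA [- _ + _]addrC -scalerBr opprB.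
    by rewrite [p - x + _]addrC [y - p + _]addrA subrK opprD addrA -scalerN opprB.
  apply: le_lt_trans (ler_normD _ _) _; rewrite !normrZ ger0_norm ?subr_ge0//.
  rewrite (ger0_norm t0).
  have [<-|tn0] := eqVneq 0 t; first by rewrite mul0r addr0 subr0 mul1r.
  rewrite (_ : Num.min r1 r2 = (1 - t) * Num.min r1 r2 + t * Num.min r1 r2); last ring.
  rewrite ler_ltD// ?ler_wpM2l ?subr_ge0// ?(ltW py)//.
  by rewrite ltr_pM2l// lt_def eq_sym tn0.
split; first by apply: (C1 _ _).1; apply: r1O; apply: le_ball pt; rewrite ge_min lexx.
move=> v; apply: enorm_mulmx_le => // i j.
have : `|Dmx F p - Dmx F (y + t *: (x - y))| <= 1.
  by apply: r2D; apply: le_ball pt; rewrite ge_min lexx orbT.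
move=> /(le_trans (coord_le_mx_norm _ i j)); rewrite !mxE => h1.
have h2 := coord_le_mx_norm (Dmx F p) i j; rewrite /C.
rewrite -[X in `|X|](subKr (Dmx F p i j)).
by apply: le_trans (ler_normB _ _) _; rewrite lerD//; move: h1; rewrite !mxE.
Qed.

(** The supremum tau of the times up to which the curves agree equals T: they
agree at tau by continuity, and the growth estimate applied to - |x1 - x2|^2, with a
local Lipschitz constant at x1 tau, extends the agreement beyond tau. *)
Lemma curve_unique n (O : set 'cV[R]_n) F (x1 x2 : R -> 'cV[R]_n) (T : R) :
  open O -> C1_on O F -> 0 <= T -> x1 0 = x2 0 ->
  (forall t, 0 <= t <= T -> O (x1 t) /\ is_derive t 1 x1 (F (x1 t))) ->
  (forall t, 0 <= t <= T -> O (x2 t) /\ is_derive t 1 x2 (F (x2 t))) ->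
  x1 T = x2 T.
Proof.
move=> oO C1 T0 x0 dx1 dx2.
pose S := [set t : R | 0 <= t <= T /\ forall r, 0 <= r <= t -> x1 r = x2 r].
have S0 : S 0.
  split; rewrite ?lexx// => r; rewrite -eq_le => /eqP <-//.
have hS : has_sup S by split; [exists 0|exists T => t [/andP[]]].
pose tau := sup S.
have tau0 : 0 <= tau by by apply: ub_le_sup S0; exact: hS.2.
have tauT : tau <= T by apply: ge_sup; [exists 0|move=> t [/andP[]]].
have tauI : 0 <= tau <= T by rewrite tau0.
have ctd : {for tau, continuous (fun t => x1 t - x2 t)}.
  by apply: cvgB; [exact: is_derive_continuous (dx1 _ tauI).2|
    exact: is_derive_continuous (dx2 _ tauI).2].
have eqlt r : 0 <= r -> r < tau -> x1 r = x2 r.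
  move=> r0 rtau.
  have [t [_ St] rt] := sup_gt (ex_intro _ 0 S0) rtau.
  by apply: St; rewrite r0 ltW.
have eqtau : x1 tau = x2 tau.
  have [tau00|taun0] := eqVneq tau 0; first by rewrite tau00.
  have tau1 : 0 < tau by rewrite lt_def taun0.
  apply/eqP; rewrite -subr_eq0 -normr_le0; apply/ler_addgt0Pl => e e0.
  rewrite addr0; have /cvgrPdist_le := ctd => /(_ e e0) /nbhs_ballP[d /= d0 xd].
  pose r := Num.max 0 (tau - d / 2).
  have rt : r < tau by rewrite gt_max tau1/= ltrBlDr ltrDl divr_gt0.
  have r0 : 0 <= r by rewrite le_max lexx.
  have := xd r; rewrite (eqlt r)// subrr subr0; apply.
  rewrite -ball_normE/= ger0_norm ?subr_ge0 ?ltW//.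
  have : tau - d / 2 <= r by rewrite le_max lexx orbT.
  lra.
have Stau : forall r, 0 <= r <= tau -> x1 r = x2 r.
  by move=> r /andP[r0]; rewrite le_eqVlt => /orP[/eqP->//|]; exact: eqlt.
have [tauTe|taunT] := eqVneq tau T; first by rewrite -tauTe.
have tauT' : tau < T by rewrite lt_def eq_sym taunT.
exfalso.
have [r [L [r0 L0 _ lipF]]] := C1_locally_lipschitz oO C1 (dx1 _ tauI).1.
have [d1 /= d10 xd1] : nbhs_ball tau [set t | ball (x1 tau) r (x1 t)].
  apply/nbhs_ballP; apply: (is_derive_continuous (dx1 _ tauI).2).
  exact: nbhsx_ballx.
have [d2 /= d20 xd2] : nbhs_ball tau [set t | ball (x1 tau) r (x2 t)].
  apply/nbhs_ballP; rewrite eqtau; apply: (is_derive_continuous (dx2 _ tauI).2).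
  exact: nbhsx_ballx.
pose eta := Num.min (T - tau) (Num.min d1 d2 / 2).
have dmin : 0 < Num.min d1 d2 by rewrite lt_min d10.
have eta0 : 0 < eta by rewrite lt_min subr_gt0 tauT' divr_gt0.
have etaT : eta <= T - tau by rewrite ge_min lexx.
have eta12 : eta < Num.min d1 d2.
  have : eta <= Num.min d1 d2 / 2 by rewrite ge_min lexx orbT.
  lra.
have /andP[eta1 eta2] : (eta < d1) && (eta < d2) by rewrite -lt_min.
suff : S (tau + eta).
  by move=> Se; have := ub_le_sup hS.2 Se; rewrite -/tau; lra.
split; first by apply/andP; lra.
move=> t /andP[t0 teta]; have [ttau|/ltW taut] := leP t tau.
  by apply: Stau; rewrite t0.
pose q t := - edot (x1 t - x2 t) (x1 t - x2 t).
have tI s : tau <= s <= t -> 0 <= s <= T by lra.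
have dq s : tau <= s <= t ->
    is_derive s 1 q (- (2 * edot (x1 s - x2 s) (F (x1 s) - F (x2 s)))).
  move=> /tI sI.
  have db := is_deriveB (dx1 s sI).2 (dx2 s sI).2.
  have := is_deriveN (is_derive_wdot (fun=> 1) db db).
  move=> /is_derive_eq; apply; congr (- _).
  by rewrite mulr2n mulrDl mul1r /edot [X in X + _]wdotC.
have qle s : tau <= s <= t ->
    2 * L * q s <= - (2 * edot (x1 s - x2 s) (F (x1 s) - F (x2 s))).
  move=> /andP[s1 s2]; have sd : `|tau - s| <= eta.
    by rewrite ler0_norm; lra.
  have bs1 : ball (x1 tau) r (x1 s).
    by apply: xd1; rewrite -ball_normE/= (le_lt_trans sd).
  have bs2 : ball (x1 tau) r (x2 s).
    by apply: xd2; rewrite -ball_normE/= (le_lt_trans sd).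
  have := lipF _ _ bs1 bs2 => /(ler_wpM2l (enorm_ge0 (x1 s - x2 s))).
  have := le_trans (ler_norm _) (edot_CS (x1 s - x2 s) (F (x1 s) - F (x2 s))).
  move=> /le_trans h /h; rewrite /q mulrCA -expr2 enorm_sqr; lra.
have := exp_growth taut dq qle.
rewrite {1}/q eqtau subrr /edot -(scale0r 0) wdotZl mul0r oppr0 mulr0 /q.
rewrite oppr_ge0 -/(edot _ _) -enorm_sqr => e2.
apply/eqP; rewrite -subr_eq0; apply/eqP/enorm_eq0/eqP.
by rewrite -sqrf_eq0 eq_le e2 sqr_ge0.
Qed.

End Flows.

(** * From forward trajectories to the flow *)

Section LocalFlow.
Context {R : realType} {n : nat}.
Implicit Types (O : set 'cV[R]_n) (F : 'cV[R]_n -> 'cV[R]_n) (p : 'cV[R]_n).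

Lemma compact_enorm_ball p (r : R) : compact [set q | enorm (q - p) <= r].
Proof.
have tc : {within [set q : 'cV[R]_n | enorm q <= r], continuous (fun q => q + p)}.
  apply: continuous_subspaceT; apply: (@lipschitz_norm_continuous _ _ _ _ 1) => x y.
  by rewrite mul1r opprD addrACA subrr addr0.
have := continuous_compact tc (@compact_enorm_le R n r).
congr compact; apply/seteqP; split => x /=.
  by move=> [y yr <-]; rewrite addrK.
by move=> xr; exists (x - p) => //; rewrite subrK.
Qed.

(** Euler orbits of - F started at p move with bounded speed, so they stay in a small
closed ball, where F is Lipschitz, for a time e that does not depend on the step. *)
Lemma backward_curve O F p : open O -> C1_on O F -> O p ->
  exists (e C : R) (y : R -> 'cV[R]_n), [/\ 0 < e, y 0 = p,
    forall t, 0 <= t <= e -> O (y t) &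
    forall s t, 0 <= s <= e -> 0 <= t <= e ->
      `|y t - y s + (t - s) *: F (y s)| <= C * (t - s) ^+ 2].
Proof.
move=> oO C1 Op.
have [r [L [r0 L0 rO lipF]]] := C1_locally_lipschitz oO C1 Op.
pose rho := r / 2; have rho0 : 0 < rho by rewrite divr_gt0.
pose K := [set q : 'cV[R]_n | enorm (q - p) <= rho].
have Kball q : K q -> ball p r q.
  move=> /= Kq; rewrite -ball_normE/= distrC.
  apply: le_lt_trans (mx_norm_le_enorm _) _; apply: le_lt_trans Kq _.
  by rewrite /rho; lra.
pose m := enorm (F p) + L * rho + 1.
have m0 : 0 < m by rewrite ltr_wpDl// addr_ge0 ?enorm_ge0// mulr_ge0// ltW.
pose G q := - F q.
have Kp : K p by rewrite /K/= subrr enorm0 ltW.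
have Gm q : K q -> enorm (G q) <= m.
  move=> Kq; rewrite enormN -(subrK (F p) (F q)).
  apply: le_trans (ler_enormD _ _) _.
  have := lipF _ _ (Kball _ Kq) (Kball _ Kp).
  by have := ler_wpM2l L0 Kq; rewrite /m; lra.
pose e := rho / m; have e0 : 0 < e by rewrite divr_gt0.
have stay h k : 0 <= h -> h * k%:R <= e ->
    enorm (euler h G p k - p) <= m * (h * k%:R).
  move=> h0; elim: k => [|k IH] hk.
    by rewrite /euler/= subrr enorm0 !mulr0.
  have hk' : h * k%:R <= e.
    by apply: le_trans hk; rewrite ler_wpM2l// ler_nat.
  rewrite eulerS addrAC; apply: le_trans (ler_enormD _ _) _.
  apply: le_trans (lerD (IH hk') (_ : _ <= h * m)) _; last by rewrite -natr1; lra.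
  rewrite enormZ ger0_norm// ler_wpM2l// Gm//=.
  apply: le_trans (IH hk') _; apply: le_trans (ler_wpM2l (ltW m0) hk') _.
  by rewrite /e mulrC divfK// gt_eqF.
have cK : compact K by exact: compact_enorm_ball.
have Ln0 : 0 <= L * n%:R by rewrite mulr_ge0.
have lipG x y : K x -> K y -> `|G x - G y| <= L * n%:R * `|x - y|.
  move=> Kx Ky; apply: le_trans (mx_norm_le_enorm _) _.
  rewrite -opprD enormN; apply: le_trans (lipF _ _ (Kball _ Kx) (Kball _ Ky)) _.
  by rewrite -mulrA ler_wpM2l// enorm_le_mx_norm.
have Gm' q : K q -> `|G q| <= m.
  by move=> /Gm; apply: le_trans; exact: mx_norm_le_enorm.
have [|y [yK yq yC]] := @euler_limit R _ K G _ m (fun=> p) [set t | t <= e]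
    cK Ln0 (ltW m0) lipG Gm'.
  move=> t /= te; apply: nearW => k j jt /=.
  have hj : k.+1%:R^-1 * j%:R <= e by rewrite mulrC (le_trans jt).
  apply: le_trans (stay _ _ _ hj) _; first by rewrite invr_ge0.
  apply: le_trans (ler_wpM2l (ltW m0) hj) _.
  by rewrite /e mulrC divfK// gt_eqF.
exists e, (2 * (L * n%:R * m)), y; split => //.
- apply: (yC [set p]) => //; last exact: ltW.
  apply: accessible_closed_set1; apply: hausdorff_accessible.
  exact: norm_hausdorff.
- by move=> t /andP[t0 te]; apply/rO/Kball/yK.
- move=> s t /andP[s0 se] /andP[t0 te].
  by have := yq s t s0 t0 se te; rewrite scalerN opprK.
Qed.

(** The times of an integral curve form an open interval around 0, hence the
backward piece.  The second-order expansion at 0 holds on both sides, so the glued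
curve is differentiable there. *)
Lemma integral_curve_forward O F p (C : R) (x : R -> 'cV[R]_n) :
  open O -> C1_on O F -> x 0 = p -> (forall t, 0 <= t -> O (x t)) ->
  (forall s t, 0 <= s -> 0 <= t ->
     `|x t - x s - (t - s) *: F (x s)| <= C * (t - s) ^+ 2) ->
  forall b, 0 < b -> exists a (xx : R -> 'cV[R]_n),
    integral_curve O F a b p xx /\ forall t, 0 <= t -> xx t = x t.
Proof.
move=> oO C1 x0 xO xq b b0.
have Op : O p by rewrite -x0; exact: xO.
have [e [C' [y [e0 y0 yO yq]]]] := backward_curve oO C1 Op.
pose xx t := if 0 <= t then x t else y (- t).
exists (- e), xx; split; last by move=> t t0; rewrite /xx t0.
split; first by rewrite in_itv/= oppr_lt0 e0.
  by rewrite /xx lexx.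
move=> s; rewrite in_itv/= => /andP[es sb].
have xyneg s' t : s' <= 0 -> t <= 0 -> - e <= s' -> - e <= t ->
    `|y (- t) - y (- s') - (t - s') *: F (y (- s'))| <= C' * (t - s') ^+ 2.
  move=> s0 t0 es' et.
  have := yq (- s') (- t); rewrite !oppr_ge0 s0 t0 (lerNl s' e) (lerNl t e) es' et => /(_ isT isT).
  by rewrite -opprD scaleNr sqrrN.
split.
  rewrite /xx; case: ifPn => [s0|]; first exact: xO.
  by rewrite -ltNge => s0; apply: yO; rewrite oppr_ge0 ltW//= (lerNl s e) ltW.
have [s0|s0|s0] := ltgtP s 0.
- apply: (@quadratic_is_derive _ _ _ _ _ C').
  have : \forall t \near s, - e < t < 0.
    by have := @near_in_itvoo R (- e) 0 s; rewrite in_itv/= es s0 => /(_ isT).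
  apply: filterS => t /andP[et t0]; rewrite /xx (leNgt 0 t) (leNgt 0 s) t0 s0 /=.
  by apply: xyneg; exact: ltW.
- apply: (@quadratic_is_derive _ _ _ _ _ C).
  have : \forall t \near s, 0 < t by exact: lt_nbhsr.
  apply: filterS => t t0; rewrite /xx (ltW t0) (ltW s0); apply: xq; exact: ltW.
- rewrite s0; apply: (@quadratic_is_derive _ _ _ _ _ (Num.max C C')).
  have : \forall t \near (0 : R), - e < t by apply: lt_nbhsr; rewrite oppr_lt0.
  apply: filterS => t et; rewrite {2 3}/xx lexx {1}/xx; case: ifPn => [t0|].
    apply: le_trans (xq _ _ (lexx 0) t0) _.
    by rewrite ler_wpM2r ?sqr_ge0// le_max lexx.
  rewrite -ltNge => t0; have := xyneg 0 t (lexx 0) (ltW t0).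
  rewrite oppr_le0 (ltW e0) (ltW et) !oppr0 x0 y0 => /(_ isT isT) /le_trans; apply.
  by rewrite ler_wpM2r ?sqr_ge0// le_max lexx orbT.
Qed.

Lemma integral_curve_flow O F p a b x (t : R) :
  open O -> C1_on O F -> integral_curve O F a b p x -> 0 <= t -> t < b ->
  flow O F t p = x t.
Proof.
move=> oO C1 [a0b x0 dx] t0 tb.
have tv : flow_values O F t p (x t).
  exists a, b, x; split => //; move: a0b; rewrite !in_itv/= => /andP[a0 _].
  by rewrite (lt_le_trans a0)//=.
rewrite /flow; case: xgetP => [y _ |/(_ _ tv)//].
move=> [a' [b' [x' [[a0b' x0' dx'] tab' <-]]]].
move: a0b a0b' tab'; rewrite !in_itv/= => /andP[a0 _] /andP[a0' _] /andP[_ tb'].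
apply: (@curve_unique _ _ O F _ _ t) => //; first by rewrite x0 x0'.
  by move=> s /andP[s0 st]; apply: dx'; rewrite in_itv/= (lt_le_trans a0')// (le_lt_trans st).
by move=> s /andP[s0 st]; apply: dx; rewrite in_itv/= (lt_le_trans a0)// (le_lt_trans st).
Qed.

End LocalFlow.

(** * Cone inequalities *)

Section Blocks.
Context {R : realType} {u s : nat}.
Implicit Types (p q z : 'cV[R]_(u + s)).

(** wdot (cone_weight k) z is half the differential at z of the quadratic form cone k. *)
Definition cone_weight (k : R) (i : 'I_(u + s)) : R :=
  if fintype.split i is inl _ then 1 else - k.

Definition cone (k : R) z : R := wdot (cone_weight k) z z.

Lemma wdot_cone_weight k p q : wdot (cone_weight k) p q =
  edot (usubmx p) (usubmx q) - k * edot (dsubmx p) (dsubmx q).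
Proof.
rewrite /edot /wdot big_split_ord/=; congr (_ + _).
  apply: eq_bigr => i _; rewrite /cone_weight !mxE.
  by case: split_ordP => [j|j /eqP]; rewrite ?eq_lrshift.
rewrite -mulNr mulr_sumr; apply: eq_bigr => i _; rewrite /cone_weight !mxE.
by case: split_ordP => [j /eqP|j _]; rewrite ?eq_rlshift// mul1r.
Qed.

Lemma coneE k z : cone k z = enorm (usubmx z) ^+ 2 - k * enorm (dsubmx z) ^+ 2.
Proof. by rewrite /cone wdot_cone_weight !enorm_sqr. Qed.

Lemma enorm_sqr_block z :
  enorm z ^+ 2 = enorm (usubmx z) ^+ 2 + enorm (dsubmx z) ^+ 2.
Proof.
rewrite !enorm_sqr /edot {1}/wdot big_split_ord/=; congr (_ + _).
  by apply: eq_bigr => i _; rewrite !mxE.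
by apply: eq_bigr => i _; rewrite !mxE.
Qed.

Lemma enorm_usubmx_le z : enorm (usubmx z) <= enorm z.
Proof.
rewrite -(@ler_pXn2r _ 2)// ?nnegrE ?enorm_ge0//.
by rewrite enorm_sqr_block lerDl sqr_ge0.
Qed.

Lemma enorm_dsubmx_le z : enorm (dsubmx z) <= enorm z.
Proof.
rewrite -(@ler_pXn2r _ 2)// ?nnegrE ?enorm_ge0//.
by rewrite enorm_sqr_block lerDr sqr_ge0.
Qed.

Lemma enorm_col_mx_le (x : 'cV[R]_u) (y : 'cV[R]_s) :
  enorm (col_mx x y) <= enorm x + enorm y.
Proof.
rewrite -(@ler_pXn2r _ 2)// ?nnegrE ?addr_ge0 ?enorm_ge0//.
rewrite enorm_sqr_block col_mxKu col_mxKd sqrrD.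
have := mulr_ge0 (enorm_ge0 x) (enorm_ge0 y); rewrite mulr2n; lra.
Qed.

Lemma cone_ge k z : 0 <= k -> - k * enorm z ^+ 2 <= cone k z.
Proof.
move=> k0; rewrite coneE enorm_sqr_block.
have := mulr_ge0 k0 (sqr_ge0 (enorm (usubmx z))).
have := sqr_ge0 (enorm (usubmx z)); lra.
Qed.

Lemma cone_le k z : 0 <= k -> cone k z <= enorm z ^+ 2.
Proof.
move=> k0; rewrite coneE enorm_sqr_block.
have := mulr_ge0 k0 (sqr_ge0 (enorm (dsubmx z))).
have := sqr_ge0 (enorm (dsubmx z)); lra.
Qed.

Lemma qform_shift n (a : 'M[R]_n) (t : R) (x : 'cV[R]_n) :
  qform (a + t%:M) x = edot x (a *m x) + t * enorm x ^+ 2.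
Proof.
rewrite /qform mulmxDr mulmxDl mxE; congr (_ + _).
  rewrite -mulmxA mxE; apply: eq_bigr => i _.
  by rewrite mul1r mxE.
rewrite mul_mx_scalar -scalemxAl mxE enorm_sqr; congr (_ * _).
by rewrite mxE; apply: eq_bigr => i _; rewrite mul1r mxE.
Qed.

(** Young's inequality, which accounts for the factors 1/2 in the cone conditions. *)
Lemma cross_term_le m n (e : 'M[R]_(m, n)) (x : 'cV[R]_m) (y : 'cV[R]_n) :
  `|edot x (e *m y)| <= 2^-1 * opnorm e * (enorm x ^+ 2 + enorm y ^+ 2).
Proof.
apply: le_trans (edot_CS _ _) _.
apply: le_trans (ler_wpM2l (enorm_ge0 x) (enorm_mulmx_opnorm e y)) _.
have := mulr_ge0 (opnorm_ge0 e) (sqr_ge0 (enorm x - enorm y)).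
by rewrite sqrrB mulr2n; lra.
Qed.

(** With z = (x, y), the pairing is x^T A x + x^T e1 y - k y^T e2 x - k y^T B y, and
cross_term_le distributes the two cross terms over |x|^2 and |y|^2. *)
Lemma cone_condition k c (P : 'M[R]_(u + s)) : 0 < k ->
  (forall x, x != 0 -> c * enorm x ^+ 2 <
     qform (ulsubmx P - (2^-1 * (opnorm (ursubmx P) + k * opnorm (dlsubmx P)))%:M) x) ->
  (forall y, y != 0 ->
     qform (drsubmx P + (2^-1 * (opnorm (dlsubmx P) + k^-1 * opnorm (ursubmx P)))%:M) y <
     c * enorm y ^+ 2) ->
  forall z, z != 0 -> c * cone k z < wdot (cone_weight k) z (P *m z).
Proof.
move=> k0 hx hy z zn0.
set a := ulsubmx P in hx; set e1 := ursubmx P in hx hy.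
set e2 := dlsubmx P in hx hy; set b := drsubmx P in hy.
set x := usubmx z; set y := dsubmx z.
have Pz : P *m z = col_mx (a *m x + e1 *m y) (e2 *m x + b *m y).
  by rewrite -[P in LHS]submxK -[z in LHS]vsubmxK mul_block_col.
have edotDr n (p1 p2 p3 : 'cV[R]_n) : edot p1 (p2 + p3) = edot p1 p2 + edot p1 p3.
  exact: wdotDr.
rewrite coneE wdot_cone_weight Pz col_mxKu col_mxKd !edotDr -/x -/y.
have hx1 : x != 0 -> c * enorm x ^+ 2 <
    edot x (a *m x) - 2^-1 * (opnorm e1 + k * opnorm e2) * enorm x ^+ 2.
  by move=> /hx; rewrite -scalemx1 -scaleNr scalemx1 qform_shift mulNr.
have hy1 : y != 0 -> k * edot y (b *m y) +
    2^-1 * (k * opnorm e2 + opnorm e1) * enorm y ^+ 2 < k * (c * enorm y ^+ 2).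
  move=> /hy; rewrite -(ltr_pM2l k0) qform_shift mulrDr.
  rewrite (_ : k * (2^-1 * _ * _) =
    2^-1 * (k * opnorm e2 + k * k^-1 * opnorm e1) * enorm y ^+ 2); last ring.
  by rewrite mulfV ?mul1r// gt_eqF.
have /andP[c1 _] : - (2^-1 * opnorm e1 * (enorm x ^+ 2 + enorm y ^+ 2)) <=
    edot x (e1 *m y) <= 2^-1 * opnorm e1 * (enorm x ^+ 2 + enorm y ^+ 2).
  by rewrite -ler_norml cross_term_le.
have /(ler_wpM2l (ltW k0)) c2 : edot y (e2 *m x) <=
    2^-1 * opnorm e2 * (enorm y ^+ 2 + enorm x ^+ 2).
  exact: le_trans (ler_norm _) (cross_term_le _ _ _).
have [x0|x0] := eqVneq x 0; have [y0|y0] := eqVneq y 0.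
- by move: zn0; rewrite -[z]vsubmxK -/x -/y x0 y0 col_mx0 eqxx.
- have := hy1 y0; move: c1 c2; rewrite x0 !mulmx0 !enorm0 /edot.
  rewrite -(scale0r (0 : 'cV[R]_u)) !wdotZl -(scale0r (0 : 'cV[R]_s)) !wdotZr; lra.
- have := hx1 x0; move: c1 c2; rewrite y0 !mulmx0 !enorm0 /edot.
  rewrite -(scale0r (0 : 'cV[R]_s)) !wdotZl -(scale0r (0 : 'cV[R]_u)) !wdotZr; lra.
- by have := hx1 x0; have := hy1 y0; lra.
Qed.

End Blocks.

Section ConeSlack.
Context {R : realType} {u s : nat}.
Implicit Types (p q z : 'cV[R]_(u + s)) (F : 'cV[R]_(u + s) -> 'cV[R]_(u + s)).

Lemma cvg_wdot_mulmx (T : Type) (H : set_system T) (n : nat) (sg : 'I_n -> R)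
    (A : T -> 'M[R]_n) (x : T -> 'cV[R]_n) (A0 : 'M[R]_n) (x0 : 'cV[R]_n) :
  Filter H -> A t @[t --> H] --> A0 -> x t @[t --> H] --> x0 ->
  wdot sg (x t) (A t *m x t) @[t --> H] --> wdot sg x0 (A0 *m x0).
Proof.
move=> FH cA cx.
have cc m k (B : T -> 'M[R]_(m, k)) (B0 : 'M[R]_(m, k)) i j : B t @[t --> H] --> B0 ->
    B t i j @[t --> H] --> B0 i j.
  move=> cB.
  exact: (@cvg_comp _ _ _ B (fun M => M i j) _ _ _ cB (@coord_continuous R m k i j B0)).
apply: cvg_big => [|i _]; first exact: add_continuous.
apply: cvgM; first exact: cvg_cst.
apply: cvgM; first exact: cc.
rewrite mxE; under eq_fun do rewrite mxE.
apply: cvg_big => [|j _]; first exact: add_continuous.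
by apply: cvgM; exact: cc.
Qed.

(** Strict inequality on the compact set N x sphere gives a margin d; homogeneity in z
removes the restriction to the sphere. *)
Lemma cone_slack (N : set 'cV[R]_(u + s)) F k c : compact N ->
  (forall p, N p -> {for p, continuous (Dmx F)}) ->
  (forall p, N p -> forall z, z != 0 ->
     c * cone k z < wdot (cone_weight k) z (Dmx F p *m z)) ->
  exists2 d : R, 0 < d & forall p, N p -> forall z,
     c * cone k z + d * enorm z ^+ 2 <= wdot (cone_weight k) z (Dmx F p *m z).
Proof.
move=> cN cD pos.
pose S := [set z : 'cV[R]_(u + s) | enorm z = 1].
have cS : compact S.
  apply: (subclosed_compact _ (@compact_enorm_le R (u + s) 1)); last first.
    by move=> z /= ->.
  apply: (@closed_comp _ _ (@enorm R _) [set t | t = 1]).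
    by move=> ? _; exact: enorm_continuous.
  exact: closed_eq.
pose f (pz : 'cV[R]_(u + s) * 'cV[R]_(u + s)) : R :=
  wdot (cone_weight k) pz.2 (Dmx F pz.1 *m pz.2) - c * wdot (cone_weight k) pz.2 (1%:M *m pz.2).
have scale_bound d : (forall p z, N p -> S z -> d <= f (p, z)) -> forall p, N p ->
    forall z, c * cone k z + d * enorm z ^+ 2 <= wdot (cone_weight k) z (Dmx F p *m z).
  move=> df p Np z.
  have [->|zn0] := eqVneq z 0.
    by rewrite /cone enorm0 expr0n/= -(scale0r 0) !wdotZl !mul0r !mulr0 addr0.
  have z0 : 0 < enorm z.
    by rewrite lt_def enorm_ge0 andbT; apply: contra_neq zn0 => /enorm_eq0.
  have Sz : S ((enorm z)^-1 *: z).
    by rewrite /S/= enormZ ger0_norm ?invr_ge0 ?enorm_ge0// mulVf// gt_eqF.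
  have := df p _ Np Sz; rewrite /f/= mul1mx -scalemxAr !wdotZl !wdotZr -/(cone k z).
  set W := wdot _ _ _; rewrite (_ : _ - _ = (W - c * cone k z) / enorm z ^+ 2).
    by rewrite ler_pdivlMr ?exprn_gt0//; lra.
  by rewrite -exprVn; ring.
have [NS0|/set0P NS0] := eqVneq (N `*` S) set0.
  exists 1 => //; apply: scale_bound => p z Np Sz.
  by have : (N `*` S) (p, z) by []; rewrite NS0.
have fc : {within N `*` S, continuous f}.
  apply: continuous_in_subspaceT => -[p z]; rewrite inE /= => -[/= Np Sz].
  apply: cvgB.
    apply: cvg_wdot_mulmx; last exact: cvg_snd.
    by apply: cvg_comp; [exact: cvg_fst|exact: cD].
  apply: cvgM; first exact: cvg_cst.
  by apply: cvg_wdot_mulmx; [exact: cvg_cst|exact: cvg_snd].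
have [[p0 z0]] := compact_EVT_min NS0 (compact_setX cN cS) fc.
rewrite inE => -[/= Np0 Sz0] fmin.
exists (f (p0, z0)); last first.
  by apply: scale_bound => p z Np Sz; apply: fmin; rewrite inE.
rewrite /f/= mul1mx subr_gt0; apply: pos => //.
by apply/eqP => z00; move: Sz0; rewrite /S/= z00 enorm0 => /eqP; rewrite eq_sym oner_eq0.
Qed.

Lemma cone_difference (N : set 'cV[R]_(u + s)) F k c d :
  (forall p q (t : R), N p -> N q -> 0 <= t <= 1 -> N (q + t *: (p - q))) ->
  (forall p, N p -> differentiable F p) ->
  (forall p, N p -> forall z,
     c * cone k z + d * enorm z ^+ 2 <= wdot (cone_weight k) z (Dmx F p *m z)) ->
  forall p q, N p -> N q -> c * cone k (p - q) + d * enorm (p - q) ^+ 2 <=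
    wdot (cone_weight k) (p - q) (F p - F q).
Proof.
move=> Nconv dF pos p q Np Nq.
have [t t01 ->] := @wdot_mvt R _ (cone_weight k) (p - q) F p q
  (fun t t01 => dF _ (Nconv p q t Np Nq t01)).
exact: pos (Nconv p q t Np Nq t01) _.
Qed.

Lemma coneDZ k h (D W : 'cV[R]_(u + s)) : cone k (D + h *: W) =
  cone k D + 2 * h * wdot (cone_weight k) D W + h ^+ 2 * cone k W.
Proof. rewrite /cone wdotDl !wdotDr !wdotZl !wdotZr (wdotC _ W D); ring. Qed.

(** The term h^2 cone k (F p - F q) is at least - h^2 k L^2 |p - q|^2, which the margin
2 h d |p - q|^2 absorbs. *)
Lemma cone_euler_step (N : set 'cV[R]_(u + s)) F k c d L h : 0 <= k -> 0 <= h ->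
  h * (k * L ^+ 2) <= 2 * d ->
  (forall p q, N p -> N q -> enorm (F p - F q) <= L * enorm (p - q)) ->
  (forall p q, N p -> N q -> c * cone k (p - q) + d * enorm (p - q) ^+ 2 <=
    wdot (cone_weight k) (p - q) (F p - F q)) ->
  forall p q, N p -> N q ->
  (1 + 2 * h * c) * cone k (p - q) <= cone k ((p + h *: F p) - (q + h *: F q)).
Proof.
move=> k0 h0 hd lipF pos p q Np Nq.
rewrite opprD addrACA -scalerBr.
set D := p - q; set W := F p - F q.
rewrite coneDZ.
have h1 := ler_wpM2l h0 (pos p q Np Nq).
have h2 := ler_wpM2l (sqr_ge0 h) (cone_ge W k0).
have h3 : k * enorm W ^+ 2 <= k * L ^+ 2 * enorm D ^+ 2.
  rewrite -mulrA -exprMn ler_wpM2l// ler_pXn2r ?nnegrE ?enorm_ge0 ?lipF//.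
  exact: le_trans (enorm_ge0 _) (lipF p q Np Nq).
have h4 := ler_wpM2l (sqr_ge0 h) h3.
have h5 := ler_wpM2r (mulr_ge0 h0 (sqr_ge0 (enorm D))) hd.
rewrite -/D -/W in h1; lra.
Qed.

End ConeSlack.

(** * Fixed points and radial projection *)

Section FixedPoint.
Context {R : realType}.

(** A minimiser c of |x - T x| on the ball is a fixed point, since T c would otherwise
do strictly better. *)
Lemma contraction_fixed_point n (T : 'cV[R]_n -> 'cV[R]_n) (r q : R) :
  0 <= r -> 0 <= q -> q < 1 ->
  (forall x, enorm x <= r -> enorm (T x) <= r) ->
  (forall x y, enorm x <= r -> enorm y <= r ->
     enorm (T x - T y) <= q * enorm (x - y)) ->
  exists2 x, enorm x <= r & T x = x.
Proof.
move=> r0 q0 q1 Tr Tq; pose A := [set x : 'cV[R]_n | enorm x <= r].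
have A0 : A !=set0 by exists 0; rewrite /A/= enorm0.
have fc : {within A, continuous (fun x => enorm (x - T x))}.
  apply: (@lipschitz_within_continuous _ _ _ _ _ ((1 + q) * n%:R)) => x y Ax Ay.
  apply: le_trans (ler_dist_enorm _ _) _.
  rewrite (_ : _ - _ = (x - y) - (T x - T y)); last first.
    by rewrite !opprD !opprK addrACA.
  apply: le_trans (ler_enormB _ _) _.
  have h1 := Tq x y Ax Ay; have h2 := enorm_le_mx_norm (x - y).
  have q1' : 0 <= 1 + q by lra.
  by have := ler_wpM2l q1' h2; rewrite mulrA; lra.
have [c] := compact_EVT_min A0 (@compact_enorm_le R n r) fc.
rewrite inE => Ac cmin; exists c => //.
have := cmin (T c); rewrite inE => /(_ (Tr c Ac)).
have h := Tq _ _ Ac (Tr c Ac).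
move=> /le_trans/(_ h) h1.
have : enorm (c - T c) <= 0.
  have : 0 <= (1 - q) * 0 - (1 - q) * enorm (c - T c) by lra.
  by rewrite -mulrBr pmulr_rge0 ?subr_gt0// sub0r oppr_ge0.
move=> h2; have /enorm_eq0/eqP : enorm (c - T c) = 0.
  by apply/eqP; rewrite eq_le h2 enorm_ge0.
by rewrite subr_eq0 => /eqP.
Qed.

(** The nearest-point projection to the closed unit ball; it extends Lipschitz maps
from the ball to the whole space without increasing the Lipschitz constant. *)
Definition radial n (y : 'cV[R]_n) : 'cV[R]_n := (Num.max 1 (enorm y))^-1 *: y.

Lemma radial_id n (y : 'cV[R]_n) : enorm y <= 1 -> radial y = y.
Proof. by move=> y1; rewrite /radial max_l// invr1 scale1r. Qed.

Lemma enorm_radial n (y : 'cV[R]_n) : enorm (radial y) <= 1.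
Proof.
have m0 : 0 < Num.max 1 (enorm y) by rewrite lt_max ltr01.
rewrite enormZ ger0_norm ?invr_ge0 ?(ltW m0)// ler_pdivrMl// mulr1.
by rewrite le_max lexx orbT.
Qed.

Lemma radial_nonexpansive n (y z : 'cV[R]_n) :
  enorm (radial y - radial z) <= enorm (y - z).
Proof.
rewrite -(@ler_pXn2r _ 2)// ?nnegrE ?enorm_ge0// !enorm_sqr /edot.
rewrite /radial !wdotBl !wdotBr !wdotZl !wdotZr (wdotC _ z y).
rewrite -!/(edot _ _) -!enorm_sqr.
have CS := le_trans (ler_norm _) (edot_CS y z).
set a := enorm y in CS *; set b := enorm z in CS *.
have a0 : 0 <= a by exact: enorm_ge0.
have b0 : 0 <= b by exact: enorm_ge0.
have [a1|a1] := leP a 1; have [b1|b1] := leP b 1.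
- by rewrite invr1; lra.
- rewrite !invr1.
  have i1 : b^-1 * b = 1 by rewrite mulVf// gt_eqF// (lt_trans ltr01).
  have ib : 0 <= 1 - b^-1 by rewrite subr_ge0 invf_le1// ?(ltW b1)// (lt_trans ltr01).
  have := ler_wpM2l ib CS.
  have h : (1 - b^-1) * (a * b) <= b - 1.
    rewrite (_ : _ * (a * b) = a * (b - b^-1 * b)); last ring.
    by rewrite i1; have := @ler_wpM2r _ (b - 1) _ _ _ a1; rewrite subr_ge0 (ltW b1) mul1r; apply.
  have h2 : 2 * (b - 1) <= b ^+ 2 - 1 by have := sqr_ge0 (b - 1); rewrite sqrrB1 mulr2n; lra.
  rewrite (_ : b^-1 * (b^-1 * b ^+ 2) = (b^-1 * b) ^+ 2); last ring.
  rewrite i1 expr1n; lra.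
- rewrite !invr1.
  have i1 : a^-1 * a = 1 by rewrite mulVf// gt_eqF// (lt_trans ltr01).
  have ia : 0 <= 1 - a^-1 by rewrite subr_ge0 invf_le1// ?(ltW a1)// (lt_trans ltr01).
  have := ler_wpM2l ia CS.
  have h : (1 - a^-1) * (a * b) <= a - 1.
    rewrite (_ : _ * (a * b) = b * (a - a^-1 * a)); last ring.
    by rewrite i1; have := @ler_wpM2r _ (a - 1) _ _ _ b1; rewrite subr_ge0 (ltW a1) mul1r; apply.
  have h2 : 2 * (a - 1) <= a ^+ 2 - 1 by have := sqr_ge0 (a - 1); rewrite sqrrB1 mulr2n; lra.
  rewrite (_ : a^-1 * (a^-1 * a ^+ 2) = (a^-1 * a) ^+ 2); last ring.
  rewrite i1 expr1n; lra.
-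
  have i1 : a^-1 * a = 1 by rewrite mulVf// gt_eqF// (lt_trans ltr01).
  have j1 : b^-1 * b = 1 by rewrite mulVf// gt_eqF// (lt_trans ltr01).
  have ab0 : 0 <= 1 - a^-1 * b^-1.
    rewrite subr_ge0 mulr_ile1 ?invr_ge0// invf_le1 ?ltW// (lt_trans ltr01)//.
  have := ler_wpM2l ab0 CS.
  rewrite (_ : (1 - a^-1 * b^-1) * (a * b) = a * b - (a^-1 * a) * (b^-1 * b)); last ring.
  rewrite (_ : a^-1 * (a^-1 * a ^+ 2) = (a^-1 * a) ^+ 2); last ring.
  rewrite (_ : b^-1 * (b^-1 * b ^+ 2) = (b^-1 * b) ^+ 2); last ring.
  rewrite i1 j1 expr1n; have := sqr_ge0 (a - b); rewrite sqrrB mulr2n; lra.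
Qed.

End FixedPoint.

(** * Graph transform of the Euler map *)

Section GraphTransform.
Context {R : realType} {u s : nat}.
Implicit Types (p q z : 'cV[R]_(u + s)) (y : 'cV[R]_s).

Definition bicylinder : set 'cV[R]_(u + s) :=
  [set z | enorm (usubmx z) <= 1 /\ enorm (dsubmx z) <= 1].

Variables (F : 'cV[R]_(u + s) -> 'cV[R]_(u + s)) (h L mu rho kv kh cv ch : R).
Local Notation N := bicylinder.
Let Phi z := z + h *: F z.

Hypotheses (h0 : 0 <= h) (L0 : 0 <= L) (rho0 : 0 <= rho) (rho2 : rho ^+ 2 = kv).
Hypotheses (kvh : kv <= kh) (kh0 : 0 < kh) (ch0 : ch <= 0).
Hypotheses (hL : h * L * (1 + rho) < 1) (hmu : rho + h * mu <= 1).
Hypothesis hcv : 0 < 1 + 2 * h * cv.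
Hypothesis F0 : F 0 = 0.
Hypothesis Fmu : forall p, N p -> enorm (F p) <= mu.
Hypothesis lipF : forall p q, N p -> N q -> enorm (F p - F q) <= L * enorm (p - q).
Hypothesis conev : forall p q, N p -> N q ->
  (1 + 2 * h * cv) * cone kv (p - q) <= cone kv (Phi p - Phi q).
Hypothesis coneh : forall p, N p -> (1 + 2 * h * ch) * cone kh p <= cone kh (Phi p).

(** Defined on the whole space, because Phi need not map N to itself. *)
Definition admissible_graph (w : 'cV[R]_s -> 'cV[R]_u) :=
  w 0 = 0 /\ (forall y1 y2, enorm (w y1 - w y2) <= rho * enorm (y1 - y2)) /\
  forall y, enorm (w y) <= rho.

Local Lemma mu0 : 0 <= mu.
Proof.
apply: le_trans (Fmu (_ : N 0)); first exact: enorm_ge0.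
by split; rewrite linear0 enorm0.
Qed.

Local Lemma rho1 : rho <= 1.
Proof. by have := mulr_ge0 h0 mu0; have := hmu; lra. Qed.

Lemma bicylinder0 : bicylinder 0.
Proof. by split; rewrite linear0 enorm0. Qed.

Lemma bicylinder_col x y : enorm x <= 1 -> enorm y <= 1 -> N (col_mx x y).
Proof. by move=> x1 y1; split; rewrite ?col_mxKu ?col_mxKd. Qed.

(** The images are on the graph of w, so their difference is in the cone; Phi multiplies
cone kv of a difference at least by a positive factor. *)
Lemma graph_preimage_cone w z1 z2 : admissible_graph w -> N z1 -> N z2 ->
  usubmx (Phi z1) = w (dsubmx (Phi z1)) ->
  usubmx (Phi z2) = w (dsubmx (Phi z2)) -> cone kv (z1 - z2) <= 0.
Proof.
move=> [_ [wL _]] N1 N2 e1 e2.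
rewrite -(pmulr_rle0 _ hcv); apply: le_trans (conev N1 N2) _.
rewrite coneE !linearB/= e1 e2 subr_le0 -rho2 -exprMn.
by rewrite ler_pXn2r ?nnegrE ?enorm_ge0 ?mulr_ge0 ?enorm_ge0.
Qed.

Lemma cone_le0_lip z : cone kv z <= 0 -> enorm (usubmx z) <= rho * enorm (dsubmx z).
Proof.
rewrite coneE subr_le0 -rho2 -exprMn.
by rewrite ler_pXn2r ?nnegrE ?enorm_ge0 ?mulr_ge0 ?enorm_ge0.
Qed.

(** The equation reads x = w(y + h F_y(x, y)) - h F_x(x, y); the right-hand side depends
on x only through terms of order h. *)
Lemma graph_fixed_point w y : admissible_graph w -> enorm y <= 1 ->
  exists2 x, enorm x <= 1 &
    usubmx (Phi (col_mx x y)) = w (dsubmx (Phi (col_mx x y))).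
Proof.
move=> [w0 [wL wrho]] y1.
pose T x := w (dsubmx (Phi (col_mx x y))) - h *: usubmx (F (col_mx x y)).
have [||||x x1 Tx] := @contraction_fixed_point R u T 1 (h * L * (1 + rho)) ler01.
- by rewrite !mulr_ge0// addr_ge0.
- exact: hL.
- move=> x x1; apply: le_trans (ler_enormB _ _) _; apply: le_trans hmu.
  rewrite lerD// enormZ ger0_norm// ler_wpM2l//.
  apply: le_trans (enorm_usubmx_le _) _; apply: Fmu; exact: bicylinder_col.
- move=> x x' x1 x'1; rewrite /T.
  set z := col_mx x y; set z' := col_mx x' y.
  have Nz : N z by exact: bicylinder_col.
  have Nz' : N z' by exact: bicylinder_col.
  have zz : enorm (z - z') <= enorm (x - x').
    rewrite /z /z' opp_col_mx add_col_mx subrr.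
    by apply: le_trans (enorm_col_mx_le _ _) _; rewrite enorm0 addr0.
  have Fzz : enorm (F z - F z') <= L * enorm (x - x').
    by apply: le_trans (lipF Nz Nz') _; rewrite ler_wpM2l.
  have e1 : dsubmx (Phi z) - dsubmx (Phi z') = h *: dsubmx (F z - F z').
    rewrite -linearB -linearZ /Phi opprD addrACA -scalerBr linearD/=.
    by rewrite /z /z' opp_col_mx add_col_mx subrr col_mxKd add0r.
  rewrite opprD opprK addrACA addrC [- _ + _]addrC -scalerBr -linearB.
  apply: le_trans (ler_enormD _ _) _.
  have h1 : enorm (h *: usubmx (F z' - F z)) <= h * (L * enorm (x - x')).
    rewrite enormZ ger0_norm// ler_wpM2l//.
    by apply: le_trans (enorm_usubmx_le _) _; rewrite enorm_distC.
  have h2 : enorm (w (dsubmx (Phi z)) - w (dsubmx (Phi z'))) <=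
      rho * (h * (L * enorm (x - x'))).
    apply: le_trans (wL _ _) _; rewrite ler_wpM2l// e1 enormZ ger0_norm// ler_wpM2l//.
    by apply: le_trans (enorm_dsubmx_le _) _.
  by apply: le_trans (lerD h1 h2) _; rewrite le_eqVlt; apply/orP; left; apply/eqP; ring.
exists x => //; rewrite {1}/Phi linearD linearZ /= col_mxKu.
by rewrite -[X in X + _]Tx /T subrK.
Qed.

Lemma graph_transform w : admissible_graph w ->
  exists2 w', admissible_graph w' & forall y, enorm y <= 1 ->
    usubmx (Phi (col_mx (w' y) y)) = w (dsubmx (Phi (col_mx (w' y) y))).
Proof.
move=> aw.
have gP y : exists x, enorm y <= 1 -> enorm x <= 1 /\
    usubmx (Phi (col_mx x y)) = w (dsubmx (Phi (col_mx x y))).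
  have [y1|ny1] := boolP (enorm y <= 1); last by exists 0.
  by have [x x1 xw] := graph_fixed_point aw y1; exists x.
have [g gE] := choice gP.
have gN y : enorm y <= 1 -> N (col_mx (g y) y).
  by move=> y1; apply: bicylinder_col => //; exact: (gE y y1).1.
have gL y1 y2 : enorm y1 <= 1 -> enorm y2 <= 1 ->
    enorm (g y1 - g y2) <= rho * enorm (y1 - y2).
  move=> b1 b2; have := graph_preimage_cone aw (gN _ b1) (gN _ b2)
    (gE _ b1).2 (gE _ b2).2.
  by move/cone_le0_lip; rewrite opp_col_mx add_col_mx col_mxKu col_mxKd.
have g0 : g 0 = 0.
  have b0 : enorm (0 : 'cV[R]_s) <= 1 by rewrite enorm0.
  have := graph_preimage_cone aw (gN 0 b0) bicylinder0 (gE 0 b0).2.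
  have -> : Phi 0 = 0 by rewrite /Phi F0 scaler0 addr0.
  rewrite !linear0 => /(_ (esym aw.1)) /cone_le0_lip.
  rewrite addr0 col_mxKu col_mxKd enorm0 mulr0 => le0; apply: enorm_eq0.
  by apply/eqP; rewrite eq_le le0 enorm_ge0.
exists (g \o @radial R s); last first.
  by move=> y y1 /=; rewrite radial_id//; exact: (gE y y1).2.
have wL y1 y2 : enorm (g (radial y1) - g (radial y2)) <= rho * enorm (y1 - y2).
  apply: le_trans (gL _ _ (enorm_radial _) (enorm_radial _)) _.
  by rewrite ler_wpM2l// radial_nonexpansive.
have r0 : radial (0 : 'cV[R]_s) = 0 by rewrite /radial scaler0.
split; [by rewrite /= r0|split] => // y /=.
have := gL (radial y) 0 (enorm_radial _).
rewrite g0 enorm0 !subr0 => /(_ ler01)/le_trans; apply.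
by rewrite -[leRHS]mulr1 ler_wpM2l// enorm_radial.
Qed.

(** For kh = 1 / alpha_h, the hypothesis 1 - kh <= cone kh (x, y) means
|y|^2 <= 1 - alpha_h + alpha_h |x|^2.  It is inherited by Phi (x, y), because
cone kh is nonpositive on the cone of kv and ch <= 0; together with |x| <= 1 it gives
|y| <= 1, so the next point is in N and the induction hypothesis applies to it. *)
Lemma graph_transform_orbit (m : nat) :
  exists2 w, admissible_graph w & forall y, enorm y <= 1 ->
    1 - kh <= cone kh (col_mx (w y) y) -> forall j, (j <= m)%N ->
    N (euler h F (col_mx (w y) y) j) /\ cone kv (euler h F (col_mx (w y) y) j) <= 0.
Proof.
have start w y : admissible_graph w -> enorm y <= 1 ->
    N (col_mx (w y) y) /\ cone kv (col_mx (w y) y) <= 0.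
  move=> [w0 [wL wrho]] y1; split.
    by apply: bicylinder_col => //; exact: le_trans rho1.
  rewrite coneE col_mxKu col_mxKd subr_le0 -rho2 -exprMn.
  rewrite ler_pXn2r ?nnegrE ?enorm_ge0 ?mulr_ge0 ?enorm_ge0//.
  by have := wL y 0; rewrite w0 !subr0.
elim: m => [|m [w aw IH]].
  exists (fun=> 0); first by split => //; split => *; rewrite ?subrr enorm0// mulr_ge0 ?enorm_ge0.
  move=> y y1 _ j; rewrite leqn0 => /eqP ->; apply: (start (fun=> 0)) => //.
  by split => //; split => *; rewrite ?subrr enorm0// mulr_ge0 ?enorm_ge0.
have [w' aw' ww'] := graph_transform aw; exists w' => // y y1 inv [|j] jm.
  exact: start.
have [Nz cz] := start w' y aw' y1.
set z := col_mx (w' y) y in inv Nz cz *.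
have -> : euler h F z j.+1 = euler h F (Phi z) j by rewrite /euler iterSr.
have eqP : Phi z = col_mx (w (dsubmx (Phi z))) (dsubmx (Phi z)).
  by rewrite -(ww' y y1) vsubmxK.
have chz : cone kh z <= 0.
  by apply: le_trans cz; rewrite !coneE lerD2l lerN2; apply: ler_wpM2r => //; exact: sqr_ge0.
have inv1 : 1 - kh <= cone kh (Phi z).
  apply: le_trans (coneh Nz); apply: le_trans inv _.
  have := mulr_ge0 h0 (mulr_le0 ch0 chz); lra.
have y1' : enorm (dsubmx (Phi z)) <= 1.
  have := inv1; rewrite coneE (ww' y y1).
  have h1 : enorm (w (dsubmx (Phi z))) ^+ 2 <= 1.
    by rewrite expr_le1 ?enorm_ge0//; exact: le_trans (aw.2.2 _) rho1.
  have : kh * enorm (dsubmx (Phi z)) ^+ 2 <= kh * 1 -> enorm (dsubmx (Phi z)) <= 1.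
    by rewrite ler_pM2l// expr_le1 ?enorm_ge0.
  by move=> + h2; apply; lra.
by rewrite eqP; apply: IH; rewrite -?eqP.
Qed.

Lemma orbit_over_base (m : nat) y : kh * enorm y ^+ 2 <= kh - 1 ->
  exists2 x, enorm x <= 1 & forall j, (j <= m)%N ->
    N (euler h F (col_mx x y) j) /\ cone kv (euler h F (col_mx x y) j) <= 0.
Proof.
move=> ykh; have [w [w0 [wL wrho]] wP] := graph_transform_orbit m.
exists (w y); first exact: le_trans rho1.
apply: wP.
  have : kh * enorm y ^+ 2 <= kh * 1 by lra.
  by rewrite ler_pM2l// expr_le1 ?enorm_ge0.
rewrite coneE col_mxKu col_mxKd; have := sqr_ge0 (enorm (w y)); lra.
Qed.

End GraphTransform.

(** * The strong stable set is contained in a Lipschitz graph *)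

Section StableManifold.
Context {R : realType} {u s : nat}.
Implicit Types (O N V : set 'cV[R]_(u + s)) (p q z : 'cV[R]_(u + s)).
Implicit Types (F : 'cV[R]_(u + s) -> 'cV[R]_(u + s)).

Lemma col_prod_closed_balls (r1 r2 : R) : 0 < r1 -> 0 < r2 ->
  col_prod (closure (@eball R u 0 r1)) (closure (@eball R s 0 r2)) =
  [set z | enorm (usubmx z) <= r1 /\ enorm (dsubmx z) <= r2].
Proof.
move=> r10 r20; rewrite /col_prod !closure_eball//; apply/seteqP; split => z /=.
  by move=> [x xr [y yr <-]]; rewrite col_mxKu col_mxKd.
move=> [zu zd]; exists (usubmx z) => //; exists (dsubmx z) => //.
by rewrite vsubmxK.
Qed.

Lemma usubmx_continuous : continuous (@usubmx R u s 1).
Proof.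
apply: (@lipschitz_norm_continuous _ _ _ _ 1) => x y; rewrite mul1r -linearB.
rewrite [leLHS]/Num.Def.normr/= mx_normrE; apply: bigmax_le => // -[i j] _ /=.
by rewrite mxE; exact: coord_le_mx_norm.
Qed.

Lemma dsubmx_continuous : continuous (@dsubmx R u s 1).
Proof.
apply: (@lipschitz_norm_continuous _ _ _ _ 1) => x y; rewrite mul1r -linearB.
rewrite [leLHS]/Num.Def.normr/= mx_normrE; apply: bigmax_le => // -[i j] _ /=.
by rewrite mxE; exact: coord_le_mx_norm.
Qed.

Lemma cone_continuous k : continuous (@cone R u s k).
Proof.
move=> z; rewrite /continuous_at.
have -> : cone k = (fun z => wdot (cone_weight k) z (1%:M *m z)) :> ('cV[R]_(u + s) -> R).
  by apply/funext => v; rewrite mul1mx.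
by apply: (@cvg_wdot_mulmx _ _ (nbhs z) _ _ (fun=> 1%:M) id) => //; exact: cvg_cst.
Qed.

Lemma compact_bicylinder : compact (@bicylinder R u s).
Proof.
apply: (subclosed_compact _ (@compact_enorm_le R (u + s) 2)); last first.
  move=> z [zu zd] /=; rewrite -[z]vsubmxK.
  by apply: le_trans (enorm_col_mx_le _ _) _; lra.
apply: closedI.
  apply: (@closed_comp _ _ (fun z => enorm (usubmx z)) [set t | t <= 1]).
    move=> z _; apply: (@continuous_comp _ _ _ (@usubmx R u s 1) (@enorm R u)).
      exact: usubmx_continuous.
    exact: enorm_continuous.
  exact: closed_le.
apply: (@closed_comp _ _ (fun z => enorm (dsubmx z)) [set t | t <= 1]).
  move=> z _; apply: (@continuous_comp _ _ _ (@dsubmx R u s 1) (@enorm R s)).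
      exact: dsubmx_continuous.
  exact: enorm_continuous.
exact: closed_le.
Qed.

Lemma bicylinder_convex p q (t : R) : bicylinder p -> bicylinder q ->
  0 <= t <= 1 -> bicylinder (q + t *: (p - q)).
Proof.
have conv n (x y : 'cV[R]_n) : enorm x <= 1 -> enorm y <= 1 -> 0 <= t <= 1 ->
    enorm (y + t *: (x - y)) <= 1.
  move=> x1 y1 /andP[t0 t1].
  rewrite (_ : y + _ = (1 - t) *: y + t *: x); last first.
    by rewrite scalerBr scalerBl scale1r addrA addrAC.
  apply: le_trans (ler_enormD _ _) _; rewrite !enormZ !ger0_norm ?subr_ge0//.
  have t1' : 0 <= 1 - t by lra.
  have := ler_wpM2l t0 x1; have := ler_wpM2l t1' y1; lra.
move=> [pu pd] [qu qd] t01; split; rewrite linearD linearZ linearB/=; exact: conv.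
Qed.

(** The bound on opnorm makes the infima and suprema that of bounded sets. *)
Lemma Dmx_in_enclosure N F (L : R) p :
  (forall q, N q -> opnorm (Dmx F q) <= L) -> N p ->
  deriv_enclosure N F (Dmx F p).
Proof.
move=> DL Np i j; rewrite in_itv/=; apply/andP; split.
  apply: ge_inf; last by exists p.
  exists (- L) => _ [q Nq <-]; rewrite lerNl; apply: le_trans (DL q Nq).
  by apply: le_trans (coord_le_opnorm _ i j); rewrite -normrN ler_norm.
apply: ub_le_sup; last by exists p.
exists L => _ [q Nq <-]; apply: le_trans (DL q Nq).
by apply: le_trans (coord_le_opnorm _ i j); exact: ler_norm.
Qed.

(** The function q(t) = cone k (x1 t - x2 t) satisfies q' >= 2 c q. *)
Lemma cone_growth N F k c d (x1 x2 : R -> 'cV[R]_(u + s)) (T : R) : 0 <= T -> 0 <= d ->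
  (forall p q, N p -> N q -> c * cone k (p - q) + d * enorm (p - q) ^+ 2 <=
    wdot (cone_weight k) (p - q) (F p - F q)) ->
  (forall t, 0 <= t <= T -> N (x1 t) /\ is_derive t 1 x1 (F (x1 t))) ->
  (forall t, 0 <= t <= T -> N (x2 t) /\ is_derive t 1 x2 (F (x2 t))) ->
  expR (2 * c * T) * cone k (x1 0 - x2 0) <= cone k (x1 T - x2 T).
Proof.
move=> T0 d0 pos d1 d2.
have dq t : 0 <= t <= T -> is_derive t 1 (fun t => cone k (x1 t - x2 t))
    (2 * wdot (cone_weight k) (x1 t - x2 t) (F (x1 t) - F (x2 t))).
  move=> tI; have db := is_deriveB (d1 t tI).2 (d2 t tI).2.
  have := is_derive_wdot (cone_weight k) db db.
  move=> /is_derive_eq; apply.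
  by rewrite [X in X + _]wdotC mulrDl mul1r.
have := exp_growth T0 dq; rewrite subr0; apply => t tI.
have := pos _ _ (d1 t tI).1 (d2 t tI).1.
have := mulr_ge0 d0 (sqr_ge0 (enorm (x1 t - x2 t))); lra.
Qed.

Lemma strong_stable_curve O F lambda V p (T : R) : open O -> C1_on O F ->
  strong_stable O F lambda V p -> 0 <= T ->
  exists x : R -> 'cV[R]_(u + s), x 0 = p /\ forall t, 0 <= t <= T ->
    [/\ x t = flow O F t p, V (x t) & is_derive t 1 x (F (x t))].
Proof.
move=> oO C1 [Vp _] T0.
have [[q [a [b [x [ic Tab _]]]]] _] := Vp T T0.
exists x; split; first by case: ic.
move: Tab; rewrite in_itv/= => /andP[aT Tb] t /andP[t0 tT].
have tb := le_lt_trans tT Tb.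
have fx := integral_curve_flow oO C1 ic t0 tb.
split=> //; first by rewrite -fx; exact: (Vp t t0).2.
have [a0b _ dx] := ic; apply: (dx t _).2; rewrite in_itv/= tb andbT.
by move: a0b; rewrite in_itv/= => /andP[a0 _]; exact: lt_le_trans t0.
Qed.

(** A positive value e of cone k would give exp(2 cv t) e <= (C1 + C2)^2 exp(2 ch t) for
all t >= 0. *)
Lemma strong_stable_cone O F N k ch cv d p1 p2 : open O -> C1_on O F ->
  0 <= k -> 0 <= d -> ch < cv ->
  (forall p q, N p -> N q -> cv * cone k (p - q) + d * enorm (p - q) ^+ 2 <=
    wdot (cone_weight k) (p - q) (F p - F q)) ->
  strong_stable O F ch N p1 -> strong_stable O F ch N p2 ->
  cone k (p1 - p2) <= 0.
Proof.
move=> oO C1 k0 d0 chcv pos S1 S2; rewrite leNgt; apply/negP => e0.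
have [C1' C10 B1] := S1.2; have [C2' C20 B2] := S2.2.
pose K := (C1' + C2') ^+ 2 / cone k (p1 - p2).
have K0 : 0 <= K by rewrite divr_ge0 ?sqr_ge0// ltW.
(* at this time the exponent 2 (cv - ch) T equals K, and exp K > K *)
pose T := K / (2 * (cv - ch)).
have cc : 0 < 2 * (cv - ch) by rewrite mulr_gt0// subr_gt0.
have T0 : 0 <= T by rewrite divr_ge0// ltW.
have [x1 [x10 D1]] := strong_stable_curve oO C1 S1 T0.
have [x2 [x20 D2]] := strong_stable_curve oO C1 S2 T0.
have TT : 0 <= T <= T by rewrite T0 lexx.
have grow : expR (2 * cv * T) * cone k (p1 - p2) <= cone k (x1 T - x2 T).
  rewrite -x10 -x20; apply: (cone_growth T0 d0 pos).
    by move=> t /D1[].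
  by move=> t /D2[].
have up : cone k (x1 T - x2 T) <= (C1' + C2') ^+ 2 * expR (2 * ch * T).
  apply: le_trans (cone_le _ k0) _.
  have -> : 2 * ch * T = T * ch * 2%:R by ring.
  rewrite expRM_natr -exprMn ler_pXn2r ?nnegrE ?enorm_ge0//; last first.
    by rewrite mulr_ge0 ?expR_ge0// addr_ge0 ?ltW.
  apply: le_trans (ler_enormB _ _) _; rewrite mulrDl.
  have [-> _ _] := D1 T TT; have [-> _ _] := D2 T TT.
  by apply: lerD; [exact: B1|exact: B2].
have := le_trans grow up.
rewrite -ler_pdivlMr// [leRHS]mulrAC -/K.
have -> : 2 * cv * T = 2 * ch * T + K.
  by rewrite /T; field; rewrite subr_eq0 gt_eqF.
rewrite expRD mulrC ler_pM2r ?expR_gt0//.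
by have := expR_ge1Dx K; lra.
Qed.

End StableManifold.

(** * Points of the strong stable set over every base point *)

Section Existence.
Context {R : realType} {u s : nat}.
Variables (O : set 'cV[R]_(u + s)) (F : 'cV[R]_(u + s) -> 'cV[R]_(u + s)).
Variables (L mu kv kh cv ch dv dh : R).
Local Notation N := (@bicylinder R u s).
Hypotheses (oO : open O) (NO : N `<=` O) (C1 : C1_on O F) (F0 : F 0 = 0).
Hypotheses (L0 : 0 <= L) (kv0 : 0 <= kv) (kv1 : kv < 1) (kvh : kv < kh).
Hypotheses (ch0 : ch <= 0) (dv0 : 0 < dv) (dh0 : 0 < dh).
Hypothesis Fmu : forall p, N p -> enorm (F p) <= mu.
Hypothesis lipF : forall p q, N p -> N q -> enorm (F p - F q) <= L * enorm (p - q).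
Hypothesis posv : forall p q, N p -> N q ->
  cv * cone kv (p - q) + dv * enorm (p - q) ^+ 2 <=
    wdot (cone_weight kv) (p - q) (F p - F q).
Hypothesis posh : forall p q, N p -> N q ->
  ch * cone kh (p - q) + dh * enorm (p - q) ^+ 2 <=
    wdot (cone_weight kh) (p - q) (F p - F q).

Lemma small_steps (c e : R) : 0 < e -> \forall n \near \oo, n.+1%:R^-1 * c < e.
Proof.
move=> e0; have C1' : 0 < `|c| + 1 by rewrite ltr_wpDl.
have := @cvg_harmonic R; move/cvgrPdist_lt => /(_ (e / (`|c| + 1))).
rewrite divr_gt0// => /(_ isT); apply: filterS => n.
rewrite sub0r normrN /harmonic/= ger0_norm ?invr_ge0// ltr_pdivlMr//.
apply: le_lt_trans; rewrite ler_wpM2l ?invr_ge0//.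
by rewrite (le_trans (ler_norm _))// lerDl.
Qed.

Let K := [set z | N z /\ cone kv z <= 0].

(** With step 1 / (n + 1), the number (n + 1)^2 of steps covers the times up to n + 1. *)
Lemma euler_orbits y : kh * enorm y ^+ 2 <= kh - 1 ->
  exists z0 : nat -> 'cV[R]_(u + s), (forall n, dsubmx (z0 n) = y) /\
  forall t : R, \forall n \near \oo, forall k, k%:R / n.+1%:R <= t ->
    K (euler n.+1%:R^-1 F (z0 n) k).
Proof.
move=> ykh; have kh0 : 0 < kh by exact: le_lt_trans kvh.
pose rho := Num.sqrt kv.
have rho0 : 0 <= rho by exact: sqrtr_ge0.
have rho2 : rho ^+ 2 = kv by rewrite sqr_sqrtr.
have rho1 : rho < 1.
  by rewrite -(@ltr_pXn2r _ 2)// ?nnegrE// rho2 expr1n.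
pose good n := exists2 x, enorm x <= 1 & forall j, (j <= n.+1 ^ 2)%N ->
  K (euler n.+1%:R^-1 F (col_mx x y) j).
have ev_good : \forall n \near \oo, good n.
  have sm1 := small_steps (L * (1 + rho)) ltr01.
  have sm2 : \forall n \near \oo, n.+1%:R^-1 * mu < 1 - rho.
    by apply: small_steps; rewrite subr_gt0.
  have sm3 := small_steps (- (2 * cv)) ltr01.
  have sm4 : \forall n \near \oo, n.+1%:R^-1 * (kv * L ^+ 2) < 2 * dv.
    by apply: small_steps; rewrite mulr_gt0.
  have sm5 : \forall n \near \oo, n.+1%:R^-1 * (kh * L ^+ 2) < 2 * dh.
    by apply: small_steps; rewrite mulr_gt0.
  near=> n.
  have h0 : 0 <= n.+1%:R^-1 :> R by rewrite invr_ge0.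
  have hL : n.+1%:R^-1 * L * (1 + rho) < 1 by rewrite -mulrA; near: n.
  have hmu : rho + n.+1%:R^-1 * mu <= 1 by rewrite addrC -lerBrDr ltW//; near: n.
  have hcv : 0 < 1 + 2 * n.+1%:R^-1 * cv.
    have : n.+1%:R^-1 * (- (2 * cv)) < 1 by near: n.
    by move: n.+1%:R^-1 => h; lra.
  have hdv : n.+1%:R^-1 * (kv * L ^+ 2) <= 2 * dv by apply/ltW; near: n.
  have hdh : n.+1%:R^-1 * (kh * L ^+ 2) <= 2 * dh by apply/ltW; near: n.
  apply: (@orbit_over_base R u s F n.+1%:R^-1 L mu rho kv kh cv ch) => //.
  - exact: ltW.
  - by apply: (cone_euler_step kv0 h0 hdv lipF posv).
  - move=> p Np.
    have := cone_euler_step (ltW kh0) h0 hdh lipF posh Np bicylinder0.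
    by rewrite F0 scaler0 addr0 !subr0.
have gP n : exists x : 'cV[R]_u, good n -> forall j, (j <= n.+1 ^ 2)%N ->
    K (euler n.+1%:R^-1 F (col_mx x y) j).
  by have [[x _ gx]|ng] := pselect (good n); [exists x|exists 0].
have [x0 x0P] := choice gP.
exists (fun n => col_mx (x0 n) y); split; first by move=> n; rewrite col_mxKd.
move=> t; near=> n => k kt; apply: x0P; first by near: n.
have tn : t <= n.+1%:R.
  near: n; exists (Num.truncn `|t|) => // n /= tn.
  apply: le_trans (ler_norm t) _; apply: ltW.
  have /andP[_ /lt_le_trans] := truncn_itv (normr_ge0 t); apply.
  by rewrite ler_nat ltnS.
rewrite -(ler_nat R) natrX expr2 -ler_pdivrMr//.
exact: le_trans kt tn.
Unshelve. all: by end_near. Qed.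

(** The limit trajectory stays in K, where cone kv <= 0 gives |z|^2 <= (1 + kv) |y|^2 and
- cone kh z >= (kh - kv) |y|^2; the growth of cone kh relative to the zero trajectory
then gives the decay of |z|. *)
Lemma stable_orbit y : kh * enorm y ^+ 2 <= kh - 1 ->
  exists2 x0 : 'cV[R]_u, enorm x0 <= 1 & strong_stable O F ch N (col_mx x0 y).
Proof.
move=> ykh; have kh0 : 0 < kh by exact: le_lt_trans kvh.
have [z0 [z0y z0K]] := euler_orbits ykh.
have cK : compact K.
  have -> : K = N `&` [set z | cone kv z <= 0] by [].
  apply: compact_closedI; first exact: compact_bicylinder.
  apply: (@closed_comp _ _ (@cone R u s kv) [set t | t <= 0]).
    by move=> z _; exact: cone_continuous.
  exact: closed_le.
have Ln0 : 0 <= L * (u + s)%:R by rewrite mulr_ge0.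
have mu0 : 0 <= mu.
  by apply: le_trans (Fmu bicylinder0); exact: enorm_ge0.
have lipn p q : K p -> K q -> `|F p - F q| <= L * (u + s)%:R * `|p - q|.
  move=> [Np _] [Nq _]; apply: le_trans (mx_norm_le_enorm _) _.
  apply: le_trans (lipF Np Nq) _.
  by rewrite -mulrA ler_wpM2l// enorm_le_mx_norm.
have Fmun p : K p -> `|F p| <= mu.
  by move=> [Np _]; apply: le_trans (mx_norm_le_enorm _) _; exact: Fmu.
have [x [xK xq xC]] := @euler_limit R _ K F _ mu z0 setT cK Ln0 mu0 lipn Fmun
  (fun t _ => z0K t).
have xd : dsubmx (x 0) = y.
  apply: (xC [set z | dsubmx z = y]) => //.
  apply: (@closed_comp _ _ (@dsubmx R u s 1) [set y]).
    by move=> z _; exact: dsubmx_continuous.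
  apply: accessible_closed_set1; apply: hausdorff_accessible.
  exact: norm_hausdorff.
have xN t : 0 <= t -> N (x t) by move=> t0; exact: (xK t t0 I).1.
exists (usubmx (x 0)); first exact: (xN 0 (lexx _)).1.
have -> : col_mx (usubmx (x 0)) y = x 0 by rewrite -xd vsubmxK.
have fw T : 0 <= T -> exists a (xx : R -> 'cV[R]_(u + s)),
    integral_curve O F a (T + 1) (x 0) xx /\ forall t, 0 <= t -> xx t = x t.
  move=> T0; apply: (integral_curve_forward oO C1 (erefl _)).
  - by move=> t t0; apply/NO/xN.
  - by move=> p q p0 q0; exact: xq.
  - by rewrite ltr_wpDl.
have fl T : 0 <= T -> flow O F T (x 0) = x T.
  move=> T0; have [a [xx [ic xxE]]] := fw T T0.
  by rewrite (integral_curve_flow oO C1 ic) ?ltrDl// xxE.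
have decay T : 0 <= T -> expR (2 * ch * T) * cone kh (x 0) <= cone kh (x T).
  move=> T0; have [a [xx [ic xxE]]] := fw T T0.
  have := @cone_growth R u s N F kh ch dh xx (fun=> 0) T T0 (ltW dh0) posh.
  rewrite !subr0 !xxE//; apply.
    move=> t /andP[t0 tT]; rewrite xxE//; split; first exact: xN.
    case: ic => a0b _ dx; have [|_] := dx t; last by rewrite xxE.
    move: a0b; rewrite !in_itv/= => /andP[a0 _]; rewrite (lt_le_trans a0)//=.
    by rewrite (le_lt_trans tT)// ltrDl.
  by move=> t _; split; [exact: bicylinder0|rewrite F0; exact: is_derive_cst].
split.
  move=> t t0; rewrite fl//; split; last exact: xN.
  have [a [xx [ic xxE]]] := fw t t0.
  exists (xx t), a, (t + 1), xx; split => //; case: ic => a0b _ _.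
  move: a0b; rewrite !in_itv/= => /andP[a0 _]; rewrite (lt_le_trans a0)//=.
  by rewrite ltrDl.
have C0 : 0 < (1 + kv) * kh / (kh - kv).
  by rewrite divr_gt0 ?mulr_gt0// ?subr_gt0// ltr_wpDr.
exists (Num.sqrt ((1 + kv) * kh / (kh - kv))); first by rewrite sqrtr_gt0.
move=> t t0; rewrite fl//.
rewrite -(@ler_pXn2r _ 2)// ?nnegrE ?enorm_ge0 ?mulr_ge0 ?sqrtr_ge0 ?expR_ge0//.
rewrite exprMn [X in _ <= X * _]sqr_sqrtr ?(ltW C0)// -expRM_natr.
have -> : t * ch * 2%:R = 2 * ch * t by ring.
have := decay t t0; have [_] := xK t t0 I.
rewrite !coneE enorm_sqr_block xd => hv hh.
set X := enorm (usubmx (x t)) ^+ 2 in hv hh *.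
set Y := enorm (dsubmx (x t)) ^+ 2 in hv hh *.
set E := expR (2 * ch * t) in hh *.
have E0 : 0 <= E by exact: expR_ge0.
have khv : 0 < kh - kv by rewrite subr_gt0.
have y1 : kh * enorm y ^+ 2 <= kh by lra.
have h1 : (kh - kv) * Y <= kh * E.
  have := ler_wpM2l E0 y1; have := mulr_ge0 E0 (sqr_ge0 (enorm (usubmx (x 0)))); lra.
rewrite mulrAC ler_pdivlMr//.
have kv1' : 0 <= 1 + kv by rewrite addr_ge0.
have := ler_wpM2l kv1' h1; have := ler_wpM2r (ltW khv) hv; lra.
Qed.

End Existence.

(** * The strong stable manifold *)

Theorem theorem33 (R : realType) (u s : nat)
  (O : set 'cV[R]_(u + s)) (F : 'cV[R]_(u + s) -> 'cV[R]_(u + s))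
  (mu L M : R)
  (A : set 'M[R]_u) (E1 : set 'M[R]_(u, s))
  (E2 : set 'M[R]_(s, u)) (B : set 'M[R]_s)
  (alpha_h alpha_v c_h c_v : R) :
  let N := col_prod (closure (@eball R u 0 1)) (closure (@eball R s 0 1)) in
  let r_s := Num.sqrt (1 - alpha_h) in
  let U := col_prod (closure (@eball R u 0 1)) (closure (@eball R s 0 r_s)) in
  open O -> N `<=` O -> C1_on O F -> F 0 = 0 ->
  (forall p, N p -> enorm (F p) <= mu) ->
  (forall p, N p -> opnorm (Dmx F p) <= L) ->
  (forall p1 p2, N p1 -> N p2 ->
     opnorm (Dmx F p1 - Dmx F p2) <= M * enorm (p1 - p2)) ->
  interval_matrix A -> interval_matrix E1 ->
  interval_matrix E2 -> interval_matrix B ->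
  deriv_enclosure N F `<=` block_set A E1 E2 B ->
  0 < alpha_h < 1 -> 0 < alpha_v < 1 ->
  (forall (a : 'M[R]_u) (b : 'M[R]_s) (e1 : 'M[R]_(u, s)) (e2 : 'M[R]_(s, u)),
     A a -> B b -> E1 e1 -> E2 e2 ->
     (forall x : 'cV[R]_u, x != 0 ->
        c_h * enorm x ^+ 2 <
          qform (a - (2^-1 * (opnorm e1 + alpha_h^-1 * opnorm e2))%:M) x /\
        c_v * enorm x ^+ 2 <
          qform (a - (2^-1 * (opnorm e1 + alpha_v * opnorm e2))%:M) x) /\
     (forall y : 'cV[R]_s, y != 0 ->
        qform (b + (2^-1 * (opnorm e2 + alpha_h * opnorm e1))%:M) y <
          c_h * enorm y ^+ 2 /\
        qform (b + (2^-1 * (opnorm e2 + alpha_v^-1 * opnorm e1))%:M) y <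
          c_v * enorm y ^+ 2)) ->
  c_h < c_v -> c_h < 0 ->
  exists w : 'cV[R]_s -> 'cV[R]_u,
    [/\ forall y : 'cV[R]_s, closure (eball 0 r_s) y -> closure (eball 0 1) (w y),
        strong_stable O F c_h N `&` U =
          [set col_mx (w y) y | y in closure (eball 0 r_s)]
      & forall y1 y2 : 'cV[R]_s, closure (eball 0 r_s) y1 -> closure (eball 0 r_s) y2 ->
          enorm (w y1 - w y2) <= Num.sqrt alpha_v * enorm (y1 - y2)].
Proof.
move=> N r_s U oO NO C1 F0 Fmu DL _ _ _ _ _ encl /andP[ah0 ah1] /andP[av0 av1].
move=> conds chcv ch0.
have NE : N = @bicylinder R u s by exact: col_prod_closed_balls.
have rs0 : 0 < r_s by rewrite sqrtr_gt0 subr_gt0.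
have UE : U = [set z | enorm (usubmx z) <= 1 /\ enorm (dsubmx z) <= r_s].
  exact: col_prod_closed_balls.
have NC1 p : N p -> differentiable F p /\ {for p, continuous (Dmx F)}.
  by move=> /NO /C1.
have L0 : 0 <= L.
  apply: le_trans (DL 0 _); first exact: opnorm_ge0.
  by rewrite NE; exact: bicylinder0.
have cN : compact N by rewrite NE; exact: compact_bicylinder.
have Nconv p q (t : R) : N p -> N q -> 0 <= t <= 1 -> N (q + t *: (p - q)).
  by rewrite NE; exact: bicylinder_convex.
have lipF p q : N p -> N q -> enorm (F p - F q) <= L * enorm (p - q).
  move=> Np Nq; apply: lipschitz_on_segment => t t01.
  have Nt := Nconv p q t Np Nq t01; split; first exact: (NC1 _ Nt).1.
  move=> v; apply: le_trans (enorm_mulmx_opnorm _ _) _.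
  by rewrite ler_wpM2r ?enorm_ge0// DL.
have blocks p : N p -> block_set A E1 E2 B (Dmx F p).
  by move=> Np; apply/encl/(Dmx_in_enclosure DL).
have ahi0 : 0 < alpha_h^-1 by rewrite invr_gt0.
have posh p : N p -> forall z, z != 0 ->
    c_h * cone alpha_h^-1 z < wdot (cone_weight alpha_h^-1) z (Dmx F p *m z).
  move=> /blocks[Aa E1e E2e Bb]; have [hx hy] := conds _ _ _ _ Aa Bb E1e E2e.
  apply: cone_condition => // [x /hx[]//|y /hy[]//].
  by rewrite invrK.
have posv p : N p -> forall z, z != 0 ->
    c_v * cone alpha_v z < wdot (cone_weight alpha_v) z (Dmx F p *m z).
  move=> /blocks[Aa E1e E2e Bb]; have [hx hy] := conds _ _ _ _ Aa Bb E1e E2e.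
  by apply: cone_condition => // [x /hx[]//|y /hy[]//].
have cD p : N p -> {for p, continuous (Dmx F)} by move=> /NC1[].
have dF p : N p -> differentiable F p by move=> /NC1[].
have [dh dh0 slackh] := cone_slack cN cD posh.
have [dv dv0 slackv] := cone_slack cN cD posv.
have diffh := cone_difference Nconv dF slackh.
have diffv := cone_difference Nconv dF slackv.
have ahi1 : 1 < alpha_h^-1 by rewrite invf_gt1.
have exist y : enorm y <= r_s -> exists2 x, enorm x <= 1 &
    strong_stable O F c_h N (col_mx x y).
  move=> yr; rewrite NE; apply: (@stable_orbit R u s O F L mu alpha_v alpha_h^-1
    c_v c_h dv dh) => //; rewrite -?NE //.
  - exact: ltW.
  - exact: lt_trans ahi1.
  - exact: ltW.
  - have : enorm y ^+ 2 <= 1 - alpha_h.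
      rewrite -[leRHS]sqr_sqrtr ?subr_ge0 ?(ltW ah1)//.
      by rewrite ler_pXn2r ?nnegrE ?enorm_ge0// ltW.
    move=> /(ler_wpM2l (ltW ahi0)) /le_trans; apply.
    by rewrite mulrBr mulVf ?mulr1// gt_eqF.
have uniq p1 p2 : strong_stable O F c_h N p1 -> strong_stable O F c_h N p2 ->
    enorm (usubmx p1 - usubmx p2) <=
    Num.sqrt alpha_v * enorm (dsubmx p1 - dsubmx p2).
  move=> S1 S2.
  have := strong_stable_cone oO C1 (ltW av0) (ltW dv0) chcv diffv S1 S2.
  rewrite coneE subr_le0 !linearB -[X in _ <= X * _](sqr_sqrtr (ltW av0)) -exprMn.
  by rewrite ler_pXn2r ?nnegrE ?enorm_ge0 ?mulr_ge0 ?enorm_ge0 ?sqrtr_ge0.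
pose S y := [set x : 'cV[R]_u | enorm x <= 1 /\ strong_stable O F c_h N (col_mx x y)].
pose w y := xget 0 (S y).
have wS y : enorm y <= r_s -> S y (w y).
  move=> /exist[x x1 xS]; rewrite /w; case: xgetP => [? _ //|/(_ x)[]//].
exists w; rewrite !closure_eball//; split => [y /wS[]//||y1 y2 /wS[_ S1] /wS[_ S2]].
  rewrite UE; apply/seteqP; split => [p [Sp [pu pd]]|_ [y /= yr <-]].
    exists (dsubmx p) => //.
    have [_ Sw] := wS _ pd; have := uniq _ _ Sw Sp.
    rewrite col_mxKu col_mxKd subrr enorm0 mulr0 => le0.
    have /enorm_eq0/eqP : enorm (w (dsubmx p) - usubmx p) = 0.
      by apply/eqP; rewrite eq_le le0 enorm_ge0.
    by rewrite subr_eq0 => /eqP ->; rewrite vsubmxK.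
  have [w1 Sw] := wS y yr; split => //.
  by rewrite /= col_mxKu col_mxKd.
by have := uniq _ _ S1 S2; rewrite !col_mxKu !col_mxKd.
Qed.
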